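(* Let $M>0$, $p\in[1,\infty]$, $d\ge1$ an integer, $\beta>d/p$ and $\mathcal X=[-1,1]^d$. Consider online adversarial nonparametric regression with labels $y_t\in\mathcal Y=[-M,M]$, predictions in $\hat{\mathcal Y}\subset\mathbb R$, and benchmark class $\mathcal F=B_{W_p^\beta(\mathcal X)}(0,M)$. Then there are constants $C_1,C_2>0$, depending on $M,\mathcal X,d,\beta,p$ but independent of $n$, such that for every integer $n\ge1$ the minimax regret satisfies $$\tilde R_n(\mathcal F)\ge\begin{cases}C_1\,n^{1-\frac\beta d}&\text{if }\beta\le\frac d2,\\[2pt] C_2\,n^{1-\frac{2\beta}{2\beta+d}}&\text{if }\beta>\frac d2.\end{cases}$$
   Context: Sobolev spaces. For $r\in\mathbb N=\{0,1,2,\dots\}$ and $1\le p<\infty$, $W_p^r(\mathcal X)$ is the space of (Lebesgue classes of) functions with weak derivatives $D^\gamma f$ such that $\|f\|_{W_p^r(\mathcal X)}=(\sum_{|\gamma|_1\le r}\|D^\gamma f\|_{L_p(\mathcal X)}^p)^{1/p}<\infty$, and $\|f\|_{W_\infty^r(\mathcal X)}=\max_{|\gamma|_1\le r}\|D^\gamma f\|_{L_\infty(\mathcal X)}$. For non-integer $\beta=r+\sigma$ with $r\in\mathbb N$, $\sigma\in(0,1)$: if $p<\infty$, $W_p^\beta(\mathcal X)$ consists of $u\in W_p^r(\mathcal X)$ with finite norm $\|u\|_{W_p^\beta(\mathcal X)}=\big(\|u\|_{W_p^r(\mathcal X)}^p+\sum_{|\gamma|_1=r}(\|D^\gamma u\|_{L_p(\mathcal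 X)}^p+\|\varphi_{D^\gamma u}\|_{L_p(\mathcal X\times\mathcal X)}^p)\big)^{1/p}$, where $\varphi_v(x,y)=|v(x)-v(y)|/\|x-y\|_2^{d/p+\sigma}$; if $p=\infty$, the norm is $\|u\|_{W_\infty^\beta(\mathcal X)}=\max\{\|u\|_{W_\infty^r(\mathcal X)},\max_{|\gamma|_1=r}\sup_{x\ne y}|D^\gamma u(x)-D^\gamma u(y)|/\|x-y\|_2^\sigma\}$. When $\beta>d/p$ (with $d/\infty=0$) every class in $W_p^\beta(\mathcal X)$ has a continuous representative; $B_{W_p^\beta(\mathcal X)}(0,M)$ denotes the set of continuous representatives of the elements of norm $<M$. Minimax regret. An admissible forecasting rule is a sequence $\mathcal A=(\mathcal A_t)_{t\ge1}$ of measurable maps $\mathcal A_t:\hat{\mathcal Y}^{t-1}\times(\mathcal X\times\mathcal Y)^{t-1}\times\mathcal X\to\hat{\mathcal Y}$; at round $t$ it predicts $\hat y_t=\mathcal A_t\big((\hat y_i)_{i<t},(x_i,y_i)_{i<t},x_t\big)$. For a data sequence $(x_t,y_t)_{t\le n}\in(\mathcal X\times\mathcal Y)^n$ (fixed in advance) set $$R_n(\mathcal F)=\sup_{f\in\mathcal F}\Big\{\sum_{t=1}^n(y_t-\hat y_t)^2-\sum_{t=1}^n(y_t-f(x_t))^2\Big\},\qquad \tilde R_n(\mathcal F)=\inf_{\mathcal A}\ \sup_{(x_t,y_t)_{t\le n}\in(\mathcal X\times\mathcal Y)^n}R_n(\mathcal F),$$ the infimum being over all admissible rules. *)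

(* Defs.v *)
From HB Require Import structures.
From mathcomp Require Import all_boot all_order all_algebra.
From mathcomp Require Import all_classical all_reals all_analysis.

Set Implicit Arguments.
Unset Strict Implicit.
Unset Printing Implicit Defensive.

Import Order.TTheory GRing.Theory Num.Def Num.Theory.
Import numFieldNormedType.Exports.

Local Open Scope classical_set_scope.
Local Open Scope ring_scope.

Definition matrix_display : measure_display.
Proof. exact: default_measure_display. Qed.

Section matrix_measurable.
Context {R : realType} (m n : nat).

(* The sigma-algebra generated by the entries, i.e. the Borel sets of
   R^(m x n). *)
Definition g_sigma_entries : set (set 'M[R]_(m, n)) :=
  <<s \bigcup_(ij in [set: 'I_m * 'I_n])
        preimage_set_system setT (fun A : 'M[R]_(m, n) => A ij.1 ij.2)
          measurable >>.

Let entries0 : g_sigma_entries set0. Proof. exact: sigma_algebra0. Qed.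

Let entriesC A : g_sigma_entries A -> g_sigma_entries (~` A).
Proof. exact: sigma_algebraC. Qed.

Let entries_bigcup (F : (set _)^nat) :
  (forall i, g_sigma_entries (F i)) -> g_sigma_entries (\bigcup_i F i).
Proof. exact: sigma_algebra_bigcup. Qed.

HB.instance Definition _ := @isMeasurable.Build matrix_display
  'M[R]_(m, n) g_sigma_entries entries0 entriesC entries_bigcup.

Lemma measurable_entry (i : 'I_m) (j : 'I_n) :
  measurable_fun [set: 'M[R]_(m, n)] (fun A : 'M[R]_(m, n) => A i j).
Proof.
move=> _ B mB; apply: sub_sigma_algebra.
by exists (i, j) => //; exists B.
Qed.

Lemma measurable_fun_entryP d (T : measurableType d) (f : T -> 'M[R]_(m, n)) :
  (forall i j, measurable_fun [set: T] (fun x => f x i j)) ->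
  measurable_fun [set: T] f.
Proof.
move=> mf.
apply: (measurability (\bigcup_(ij in [set: 'I_m * 'I_n])
  preimage_set_system setT (fun A : 'M[R]_(m, n) => A ij.1 ij.2)
    measurable)) => //.
move=> _ [_ [[i j] _ [B mB <-]] <-].
by rewrite (setTI (_ @^-1` B)); exact: (mf i j measurableT).
Qed.

End matrix_measurable.

Section lebesgue_rV.
Context {R : realType}.

Definition rVcons n (xv : measurableTypeR R * 'rV[R]_n) : 'rV[R]_n.+1 :=
  \row_i (if unlift ord0 i is Some j then xv.2 0 j else xv.1).

Definition rVhead n (w : 'rV[R]_n.+1) : measurableTypeR R := w 0 ord0.
Definition rVtail n (w : 'rV[R]_n.+1) : 'rV[R]_n := \row_j w 0 (lift ord0 j).

Lemma rVconsK n :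
  cancel (@rVcons n) (fun w => (rVhead w, rVtail w)).
Proof.
case=> x v; rewrite /rVhead /rVtail /rVcons; congr (_, _).
  by rewrite mxE unlift_none.
by apply/rowP => j; rewrite !mxE liftK.
Qed.

Lemma measurable_rVcons n :
  measurable_fun [set: measurableTypeR R * 'rV[R]_n] (@rVcons n).
Proof.
apply: measurable_fun_entryP => i k.
case: (unliftP ord0 k) => [j ->|->].
- under eq_fun do rewrite mxE liftK.
  exact: (measurableT_comp (measurable_entry 0 j) measurable_snd).
- under eq_fun do rewrite mxE unlift_none.
  exact: measurable_fst.
Qed.

Lemma measurable_rVheadtail n :
  measurable_fun [set: 'rV[R]_n.+1] (fun w => (rVhead w, rVtail w)).
Proof.
apply: measurable_fun_pair.
- exact: measurable_entry.
- apply: measurable_fun_entryP => i j.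
  by under eq_fun do rewrite mxE; exact: measurable_entry.
Qed.

Section step.
Context n (mu : {sigma_finite_measure set 'rV[R]_n -> \bar R}).

Definition lebesgue_rV_step : set 'rV[R]_n.+1 -> \bar R :=
  pushforward (@lebesgue_measure R \x mu)%E (@rVcons n).

Let step0 : lebesgue_rV_step set0 = 0%E.
Proof. by rewrite /lebesgue_rV_step /pushforward preimage_set0 measure0. Qed.

Let step_ge0 A : (0 <= lebesgue_rV_step A)%E.
Proof. by rewrite /lebesgue_rV_step /pushforward measure_ge0. Qed.

Let step_sigma_additive : semi_sigma_additive lebesgue_rV_step.
Proof.
have mC A : measurable A -> measurable (@rVcons n @^-1` A).
  by move=> mA; have := measurable_rVcons measurableT mA; rewrite setTI.
move=> F mF tF mUF; rewrite /lebesgue_rV_step /pushforward preimage_bigcup.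
apply: measure_semi_sigma_additive => [i||]; first exact: mC.
  apply/trivIsetP => i j _ _ ij; rewrite -preimage_setI.
  by move/trivIsetP : tF => /(_ i j Logic.I Logic.I ij) ->; rewrite preimage_set0.
by rewrite -preimage_bigcup; exact: mC.
Qed.

HB.instance Definition _ := isMeasure.Build _ _ _ lebesgue_rV_step
  step0 step_ge0 step_sigma_additive.

Let step_sigma_finite : sigma_finite setT lebesgue_rV_step.
Proof.
have /sigma_finiteP[F [UF ndF Foo]] := sigma_finiteT (@lebesgue_measure R).
have /sigma_finiteP[G [UG ndG Goo]] := sigma_finiteT mu.
exists (fun k => (fun w => (rVhead w, rVtail w)) @^-1` (F k `*` G k)).
  rewrite -preimage_bigcup; apply/esym; rewrite -subTset => w _ /=.
  have [a _ Fa] : (\bigcup_i F i) (rVhead w) by rewrite -UF.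
  have [b _ Gb] : (\bigcup_i G i) (rVtail w) by rewrite -UG.
  exists (maxn a b) => //; split => /=.
    by move: Fa; apply/subsetPset/ndF/leq_maxl.
  by move: Gb; apply/subsetPset/ndG/leq_maxr.
move=> k; have [mF Fk] := Foo k; have [mG Gk] := Goo k; split.
  have := measurable_rVheadtail measurableT (measurableX mF mG).
  by rewrite setTI.
rewrite /lebesgue_rV_step /pushforward -comp_preimage.
rewrite (_ : _ \o _ = id); last by apply/funext => xv; exact: rVconsK.
by rewrite preimage_id product_measure1E// lte_mul_pinfty// ge0_fin_numE.
Qed.

HB.instance Definition _ := Measure_isSigmaFinite.Build _ _ _ lebesgue_rV_step
  step_sigma_finite.

End step.

Fixpoint lebesgue_rV n : {sigma_finite_measure set 'rV[R]_n -> \bar R} :=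
  if n is n'.+1 then lebesgue_rV_step (lebesgue_rV n')
  else \d_(0 : 'rV[R]_0).

End lebesgue_rV.

Section sobolev.
Context {R : realType} (d : nat).
Local Notation V := 'rV[R]_d.
Local Notation mu := (@lebesgue_rV R d).

Definition cube : set V := [set x | forall i, -1 <= x 0 i <= 1].
Definition open_cube : set V := [set x | forall i, -1 < x 0 i < 1].

(* The norm of the normed module structure on 'rV[R]_d is the sup norm. *)
Definition euclidean_norm (x : V) : R := Num.sqrt (\sum_i x 0 i ^+ 2).

Definition partial (i : 'I_d) (f : V -> R) : V -> R :=
  fun x => 'D_(delta_mx 0 i) f x.

(* All iterated partial derivatives exist and are Frechet differentiable (hence
   continuous), that is, f is of class C^oo. *)
Definition smooth (f : V -> R) : Prop :=
  forall (s : seq 'I_d) (x : V), differentiable (foldr partial f s) x.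

Definition test_function (phi : V -> R) : Prop :=
  let supp := closure [set x | phi x != 0] in
  [/\ smooth phi, compact supp & supp `<=` open_cube].

(* Multi-indices with entries at most r; those of length at most r are all of
   this form. *)
Definition multi_index (r : nat) := {ffun 'I_d -> 'I_r.+1}.
Definition mi_length r (gamma : multi_index r) : nat := (\sum_i gamma i)%N.

Definition mi_partial r (gamma : multi_index r) (f : V -> R) : V -> R :=
  foldr (fun i h => iter (gamma i) (partial i) h) f (enum 'I_d).

Definition locally_integrable_cube (f : V -> R) : Prop :=
  measurable_fun cube f /\
  forall K : set V, compact K -> K `<=` open_cube ->
    mu.-integrable K (EFin \o f).

Definition weak_derivative r (gamma : multi_index r) (f g : V -> R) : Prop :=
  [/\ locally_integrable_cube f, locally_integrable_cube g &
    forall phi, test_function phi ->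
      \int[mu]_(x in open_cube) (f x * mi_partial gamma phi x) =
      (-1) ^+ mi_length gamma * \int[mu]_(x in open_cube) (g x * phi x)].

Definition Lp_norm (p : \bar R) (g : V -> R) : \bar R :=
  Lnorm mu p (EFin \o (g \_ cube)).

Definition Lp_norm2 (p : \bar R) (h : V * V -> R) : \bar R :=
  Lnorm (mu \x mu)%E p (EFin \o (h \_ (cube `*` cube))).

(* d / p, with d / oo = 0 *)
Definition dim_over (p : \bar R) : R :=
  if p is q%:E then d%:R / q else 0.

Definition slobodeckij (p : \bar R) (sigma : R) (v : V -> R) : V * V -> R :=
  fun z => `|v z.1 - v z.2| /
           euclidean_norm (z.1 - z.2) `^ (dim_over p + sigma).

Definition hoelder_seminorm (sigma : R) (v : V -> R) : \bar R :=
  ereal_sup [set (`|v z.1 - v z.2| / euclidean_norm (z.1 - z.2) `^ sigma)%:E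
            | z in [set z : V * V | [/\ cube z.1, cube z.2 & z.1 <> z.2]]].

Local Open Scope ereal_scope.

(* The following two functionals are the norms of W_p^r and W_p^(r + sigma),
   expressed through a family D of representatives of the weak derivatives
   (only the entries of D of length at most r matter); p is finite or +oo. *)
Definition sobolev_norm_int (p : \bar R) r (D : multi_index r -> V -> R) :
    \bar R :=
  if p is q%:E then
    (\sum_(g : multi_index r | (mi_length g <= r)%N) Lp_norm p (D g) `^ q)
      `^ q^-1
  else \big[maxe/0]_(g : multi_index r | (mi_length g <= r)%N)
         Lp_norm p (D g).

Definition sobolev_norm_frac (p : \bar R) r (sigma : R)
    (D : multi_index r -> V -> R) : \bar R :=
  if p is q%:E then
    (sobolev_norm_int p D `^ q +
     \sum_(g : multi_index r | mi_length g == r)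
       (Lp_norm p (D g) `^ q +
        Lp_norm2 p (slobodeckij p sigma (D g)) `^ q)) `^ q^-1
  else maxe (sobolev_norm_int p D)
         (\big[maxe/0]_(g : multi_index r | mi_length g == r)
            hoelder_seminorm sigma (D g)).

Local Close Scope ereal_scope.

(* The infimum ranges over the choices of representatives of the weak
   derivatives of f. The L_p terms do not depend on the choice; for p = +oo and
   beta non-integer the infimum is attained by the continuous representatives
   of the top-order derivatives. The norm is +oo if some weak derivative does
   not exist. *)
Definition sobolev_norm (beta : R) (p : \bar R) (f : V -> R) : \bar R :=
  let r := Num.truncn beta in
  let sigma := beta - r%:R in
  ereal_inf
    [set (if sigma == 0 then sobolev_norm_int p D
          else sobolev_norm_frac p sigma D)
    | D in [set D : multi_index r -> V -> R |
        forall g, (mi_length g <= r)%N -> weak_derivative g f (D g)]].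

(* Values outside the cube are irrelevant. *)
Definition sobolev_ball (beta : R) (p : \bar R) (M : R) : set (V -> R) :=
  [set f | {within cube, continuous f} /\ (sobolev_norm beta p f < M%:E)%E].

End sobolev.

Arguments cube {R} d.

Section regret.
Context {R : realType} dV (V : measurableType dV).
Variables (X : set V) (Y Yhat : set R).

Definition history (t : nat) : Type :=
  (t.-tuple R * t.-tuple (V * R) * V)%type.

(* A t maps t past predictions, t past data points and the current input to a
   prediction, so it is the rule used at round t + 1. *)
Definition rule := forall t : nat, history t -> R.

Definition history_domain t : set (history t) :=
  [set h | [/\ forall i, Yhat (tnth h.1.1 i),
               forall i, X (tnth h.1.2 i).1 /\ Y (tnth h.1.2 i).2 &
               X h.2]].

(* Measurability is with respect to the trace sigma-algebras, since no
   measurability of Yhat is assumed. *)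
Definition admissible (A : rule) : Prop :=
  forall t,
    (forall h, history_domain h -> Yhat (A t h)) /\
    (forall B : set R, measurable B ->
      exists E : set (t.-tuple R * t.-tuple (V * R) * V),
        measurable E /\
        @history_domain t `&` A t @^-1` B = @history_domain t `&` E).

Fixpoint predictions (A : rule) (z : nat -> V * R) (t : nat) : t.-tuple R :=
  if t is t'.+1 then
    let past := predictions A z t' in
    [tuple of rcons past (A t' (past, [tuple z i | i < t'], (z t').1))]
  else [tuple].

Definition data n : set (n.-tuple (V * R)) :=
  [set z | forall i, X (tnth z i).1 /\ Y (tnth z i).2].
Arguments data n : clear implicits.

Definition regret (F : set (V -> R)) (A : rule) n (z : n.-tuple (V * R)) :
    \bar R :=
  let yhat := predictions A (nth point z) n in
  ereal_sup
    [set (\sum_(t < n) ((tnth z t).2 - tnth yhat t) ^+ 2 -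
          \sum_(t < n) ((tnth z t).2 - f (tnth z t).1) ^+ 2)%:E | f in F].

Definition minimax_regret (F : set (V -> R)) (n : nat) : \bar R :=
  ereal_inf [set ereal_sup [set regret F A z | z in data n]
            | A in [set A | admissible A]].

End regret.

(* Main.v *)
Require Import Defs.
From mathcomp Require Import all_boot all_order all_algebra.
From mathcomp Require Import all_classical all_reals all_analysis.
From mathcomp Require Import measurable_realfun ess_sup_inf ring lra.
Import Order.TTheory GRing.Theory Num.Theory.
Import numFieldNormedType.Exports.
Local Open Scope classical_set_scope.
Local Open Scope ring_scope.

(** The benchmark class contains every sum of bumps with arbitrary signs on a
    grid of m^d cells of side 1/m, provided that the height of the bumps is a
    small multiple h of m^(-beta). The adversary visits the centre of each cell
    T times, with m^d * T <= n, and answers M or - M. Against random labels the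
    loss of the learner is on average at least that of the constant 0; but once
    the labels are known, the sum of bumps that follows the majority sign in
    each cell gains 2 * M * h * |S| - T * h^2 per cell, where S is the
    sum of the T signs. As |S| is of order sqrt T for fair signs, the regret is
    at least of order m^d * h * sqrt T as long as h * sqrt T is small compared
    with M ([minimax_regret_ge], [minimax_regret_cells]).

    If beta <= d / 2, take T = 1 and m^d of order n: the bound is of order
    n * m^(-beta), that is, n^(1 - beta / d). If beta > d / 2, take m of order
    n^(1 / (2 * beta + d)) and T of order n / m^d, so that h * sqrt T is of
    order 1: the bound is of order m^d.

    Instead of taking an expectation over the signs, the adversary follows a
    polynomial potential which bounds |S| from below and is a martingale under
    fair signs ([potential_martingale], [potential_end], [game_potential]).

    Membership in the ball ([sobolev_norm_bump_le]) needs three things.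
    - The weak derivatives. The bumps are products of piecewise polynomials of
      one variable, with enough classical derivatives; the partial derivatives
      are moved over from the test function by Fubini and the fundamental
      theorem of calculus ([integral_partial_eq0], [weak_derivative_sepsum]).
    - Bounds that do not depend on the number of cells. At most one bump is
      nonzero at each point, so the derivatives of order k are bounded by a
      multiple of m^(k - beta), and with sigma the fractional part of beta,
      those of top order satisfy
      |v x - v y| <= L * m^(-sigma) * min(1, m * |x - y|)
      ([sepsum_bump_le], [sepsum_bump_dist]).
    - The fractional seminorm. A Hoelder bound of exponent sigma alone would
      make the Slobodeckij integral diverge logarithmically. The minimum above
      saves it: cutting the domain into dyadic shells |x - y| of order 2^j / m
      gives two convergent geometric series, in which all powers of m cancel
      ([integral_slobodeckij_le]). *)

(** * Lebesgue measure and partial derivatives on row vectors *)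

(** The closed ball of the sup norm, written by coordinates: a product of
    intervals. *)
Definition box {R : realType} {n : nat} (c : 'rV[R]_n) (r : R) : set 'rV[R]_n :=
  [set x | forall i, `|x 0 i - c 0 i| <= r].

Section rV_measure.
Context {R : realType}.

Lemma measurable_box n (c : 'rV[R]_n) (r : R) : measurable (box c r).
Proof.
rewrite (_ : box c r = \bigcap_(i in [set: 'I_n])
    ((fun x : 'rV[R]_n => x 0 i) @^-1` `[c 0 i - r, c 0 i + r])); last first.
  apply/seteqP; split => x /=.
    by move=> h i _ /=; rewrite in_itv/= -ler_distl.
  by move=> h i; have := h i I; rewrite /= in_itv/= -ler_distl.
apply: fin_bigcap_measurable => // i _.
rewrite -[X in measurable X]setTI; exact: (measurable_entry 0 i).
Qed.

Lemma rVcons0 n s (w : 'rV[R]_n) : rVcons (s, w) 0 ord0 = s.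
Proof. by rewrite /rVcons mxE unlift_none. Qed.

Lemma rVconsS n s (w : 'rV[R]_n) j : rVcons (s, w) 0 (lift ord0 j) = w 0 j.
Proof. by rewrite /rVcons mxE liftK. Qed.

Lemma box_rVcons n (c : 'rV[R]_n.+1) (r : R) s (w : 'rV[R]_n) :
  box c r (rVcons (s, w)) <->
  `|s - rVhead c| <= r /\ box (rVtail c) r w.
Proof.
split=> [h|[h0 h] i].
  split; first by have := h ord0; rewrite rVcons0.
  by move=> j; have := h (lift ord0 j); rewrite rVconsS /rVtail mxE.
case: (unliftP ord0 i) => [j ->|->]; last by rewrite rVcons0.
by rewrite rVconsS; have := h j; rewrite /rVtail mxE.
Qed.

Lemma lebesgue_rV_box n (c : 'rV[R]_n) (r : R) : 0 <= r ->
  lebesgue_rV n (box c r) = ((2 * r) ^+ n)%:E.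
Proof.
move=> r0; elim: n c => [|n IH] c.
  by rewrite /= diracE mem_set//= => -[].
rewrite /= /lebesgue_rV_step /pushforward /=.
rewrite (_ : rVcons (n:=n) @^-1` box c r =
   `[rVhead c - r, rVhead c + r] `*` box (rVtail c) r); last first.
  apply/seteqP; split => -[s w] /=; rewrite in_itv/= -ler_distl;
    by move/box_rVcons.
rewrite product_measure1E//; last exact: measurable_box.
rewrite IH.
have Hl : lebesgue_measure `[rVhead c - r, rVhead c + r] = (2 * r)%:E :> \bar R.
  rewrite lebesgue_measure_itv/= lte_fin.
  case: ltP => h; first by rewrite -EFinD; congr (_)%:E; ring.
  by congr (_)%:E; lra.
by rewrite exprS EFinM -Hl.
Qed.

(** The sigma-algebra is generated by the coordinates, and an open set is the
    union of the countably many boxes inside it with rational centre and radius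
    the inverse of an integer. *)
Lemma open_measurable_rV n (U : set 'rV[R]_n) : open U -> measurable U.
Proof.
move=> oU.
pose q2 (q : 'rV[rat]_n) : 'rV[R]_n := map_mx ratr q.
pose e (k : nat) : R := k.+1%:R^-1.
rewrite (_ : U = \bigcup_(qk in [set qk : 'rV[rat]_n * nat |
    box (q2 qk.1) (e qk.2) `<=` U]) box (q2 qk.1) (e qk.2)); last first.
  apply/seteqP; split => [x Ux|x [qk /= + bx]]; last exact.
  have /nbhs_ballP[d /= d0 dU] : nbhs x U by apply: open_nbhs_nbhs.
  have [k kd] : exists k, e k < d / 2.
    have [k hk] := @ltr_add_invr R 0 (d / 2) ltac:(by rewrite divr_gt0).
    by exists k; rewrite add0r in hk.
  have e0 : 0 < e k by rewrite invr_gt0.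
  have /choice[q hq] (i : 'I_n) : exists q :
    rat, x 0 i - e k < ratr q < x 0 i + e k.
    have [|q] := @rat_in_itvoo R (x 0 i - e k) (x 0 i + e k); first lra.
    by rewrite in_itv/=; exists q.
  have bq i : `|x 0 i - q2 (\row_i q i) 0 i| <= e k.
    by rewrite /q2 !mxE ler_distlC; have /andP[? ?] := hq i; apply/andP; split;
      lra.
  exists (\row_i q i, k) => //= y hy; apply: dU; split => // i j; rewrite !ord1.
  rewrite /ball/= -(subrKA (q2 (\row_i q i) 0 j)) (le_lt_trans (ler_normD _
    _))//.
  rewrite [ltRHS]splitr ltrD ?(le_lt_trans _ kd)// distrC; exact: hy.
rewrite bigcup_mkcond; apply: countable_bigcupT_measurable => //.
by move=> qk; case: ifP => // _; exact: measurable_box.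
Qed.

Lemma continuous_measurable_rV n (f : 'rV[R]_n -> R) :
  continuous f -> measurable_fun setT f.
Proof.
move=> /continuousP cf; apply: (measurability _ (RGenOInfty.measurableE R)).
move=> _ [_ [a ->] <-]; rewrite setTI; apply: open_measurable_rV.
by apply: cf; exact: interval_open.
Qed.


Lemma continuous_bounded_box n (f : 'rV[R]_n -> R) (c : 'rV[R]_n) (r : R) :
  continuous f -> exists2 B, 0 < B & forall x, box c r x -> `|f x| <= B.
Proof.
move=> cf.
have cb : compact (box c r).
  rewrite (_ : box c r = [set v : 'rV[R]_n |
      forall i, `[c 0 i - r, c 0 i + r]%classic (v 0 i)]); last first.
    apply/seteqP; split => x /= h i; have := h i.
      by rewrite in_itv/= -ler_distl.
    by rewrite in_itv/= -ler_distl.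
  have := @rV_compact R n (fun i => `[c 0 i - r, c 0 i + r]%classic).
  by apply=> i; exact: segment_compact.
have /compact_bounded[M [_ hM]] : compact (f @` box c r).
  by apply: continuous_compact => //; exact: continuous_subspaceT.
exists (`|M| + 1); first by rewrite ltr_wpDl.
by move=> x bx; apply: (hM (`|M| + 1)); [rewrite ltr_pwDr// ler_norm|exists x].
Qed.

Lemma integrable_bounded_support d (T : measurableType d)
    (mu : {measure set T -> \bar R}) (A : set T) (f : T -> R) (B : R) :
  measurable A -> (mu A < +oo)%E -> measurable_fun setT f ->
  (forall x, A x -> `|f x| <= B) -> (forall x, ~ A x -> f x = 0) ->
  mu.-integrable setT (EFin \o f).
Proof.
move=> mA fA mf fB f0.
have -> : EFin \o f = (EFin \o f) \_ A.
  apply/funext => x; rewrite patchE; case: ifPn => //.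
  by rewrite notin_setE => /f0 /= ->.
apply/(integrable_mkcond _ mA).1/measurable_bounded_integrable => //.
  exact: measurable_funTS.
exists B; split; first exact: num_real.
by move=> x Bx y Ay; exact: (le_trans (fB _ Ay) (ltW Bx)).
Qed.

Lemma continuous_rVcons n (s : R) :
  continuous (fun w : 'rV[R]_n => rVcons (s, w)).
Proof.
move=> w U /nbhs_ballP[e /= e0 eU].
apply/nbhs_ballP; exists e => //= w' [_ hw]; apply: eU; split => // i j;
  rewrite ord1.
case: (unliftP ord0 j) => [k ->|->]; last by rewrite !rVcons0; exact: ballxx.
by rewrite !rVconsS.
Qed.

Lemma continuous_rVcons1 n (w : 'rV[R]_n) :
  continuous (fun s : R => rVcons (s, w)).
Proof.
move=> s U /nbhs_ballP[e /= e0 eU].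
apply/nbhs_ballP; exists e => //= s' hs; apply: eU; split => // i j;
  rewrite ord1.
case: (unliftP ord0 j) => [k ->|->]; first by rewrite !rVconsS; exact: ballxx.
by rewrite !rVcons0.
Qed.

Lemma rVconsD n h s (v w : 'rV[R]_n) :
  rVcons (h + s, v + w) = rVcons (h, v) + rVcons (s, w).
Proof.
apply/rowP => j; rewrite [RHS]mxE; case: (unliftP ord0 j) => [k ->|->].
  by rewrite !rVconsS mxE.
by rewrite !rVcons0.
Qed.

Lemma rVcons_delta0 n (h : R) : rVcons (h, 0 : 'rV[R]_n) = h *: delta_mx 0 ord0.
Proof.
apply/rowP => j; case: (unliftP ord0 j) => [k ->|->].
  by rewrite rVconsS !mxE [lift _ _ == _]eq_sym (negbTE (neq_lift _ _)) andbF
    mulr0.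
by rewrite rVcons0 !mxE !eqxx mulr1.
Qed.

Lemma rVcons_deltaS n (h : R) (k : 'I_n) :
  rVcons (0, h *: delta_mx 0 k) = h *: delta_mx 0 (lift ord0 k).
Proof.
apply/rowP => j; case: (unliftP ord0 j) => [l ->|->].
  by rewrite rVconsS !mxE /= (inj_eq (@lift_inj _ _)).
by rewrite rVcons0 !mxE (negbTE (neq_lift _ _)) andbF mulr0.
Qed.

(** A directional derivative only sees the function along a line, so it can be
    read off any other function with the same values along a line. This moves
    derivatives between R, R^n and R^(n+1). *)
Lemma is_derive_line (V W : normedModType R) (f : V -> R)
  (g : W -> R) x v y w df :
  (forall h : R, f (h *: v + x) = g (h *: w + y)) ->
  is_derive x v f df -> is_derive y w g df.
Proof.
move=> fg [dF1 dF2].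
have fgx : f x = g y by have := fg 0; rewrite !scale0r !add0r.
have E : (fun h : R => h^-1 *: (f (h *: v + x) - f x)) =
         (fun h : R => h^-1 *: (g (h *: w + y) - g y)).
  by apply/funext => h; rewrite fg fgx.
by rewrite /derivable E in dF1; rewrite /derive E in dF2; constructor.
Qed.

Lemma integral_derive1_eq0 (g dg : R -> R) (r : R) : 0 < r ->
  continuous dg -> (forall s : R, is_derive s 1 g (dg s)) ->
  (forall s, r < `|s| -> g s = 0) -> (forall s, r < `|s| -> dg s = 0) ->
  (\int[lebesgue_measure]_s (dg s)%:E = 0)%E.
Proof.
move=> r0 cdg gE g0 dg0.
have cg : continuous g.
  by move=> s; apply/differentiable_continuous/derivable1_diffP;
    have [] := gE s.
rewrite (_ : (fun s => (dg s)%:E) = (EFin \o dg) \_ `[- (2 * r), 2 * r]);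
  last first.
  apply/funext => s; rewrite patchE; case: ifPn => //.
  rewrite notin_setE/= in_itv/= -ler_norml => /negP; rewrite -ltNge => h.
  by rewrite dg0//; lra.
rewrite -integral_mkcond (@continuous_FTC2 _ dg g).
- rewrite !g0 ?subee// ?normrN ger0_norm; lra.
- lra.
- exact: continuous_subspaceT.
- split.
  + by move=> s _; have [] := gE s.
  + by apply: cvg_at_right_filter; exact: cg.
  + by apply: cvg_at_left_filter; exact: cg.
- by move=> s _; rewrite derive1E; have [] := gE s.
Qed.

(** By Fubini it suffices to integrate a partial derivative of a compactly
    supported function along its own line. The measure puts coordinate 0
    first, hence the induction on the dimension. *)
Lemma integral_partial_eq0 n (i : 'I_n) (F dF : 'rV[R]_n -> R) (r : R) :
  0 < r ->
  continuous dF -> (forall x, is_derive x (delta_mx 0 i) F (dF x)) ->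
  (forall x, ~ box 0 r x -> F x = 0) -> (forall x, ~ box 0 r x -> dF x = 0) ->
  (\int[lebesgue_rV n]_x (dF x)%:E = 0)%E.
Proof.
move=> r0; elim: n i F dF => [[]//|n IH] i F dF cdF dFE F0 dF0.
have [B B0 hB] := @continuous_bounded_box _ dF 0 r cdF.
have mrV : measurable_fun setT (@rVcons R n) := @measurable_rVcons R n.
have mdF := continuous_measurable_rV _ _ cdF.
have mG : measurable_fun setT (dF \o @rVcons R n) by exact: measurableT_comp.
have mA : measurable (@rVcons R n @^-1` box 0 r).
  by have := mrV measurableT _ (@measurable_box _ 0 r); rewrite setTI.
have bhead : rVhead (0 : 'rV[R]_n.+1) = 0 by rewrite /rVhead mxE.
have btail : rVtail (0 : 'rV[R]_n.+1) = 0 by apply/rowP => k; rewrite !mxE.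
have iG : (lebesgue_measure \x lebesgue_rV n)%E.-integrable setT
    (EFin \o (dF \o @rVcons R n)).
  apply: (@integrable_bounded_support _ _ _ _ _ B mA) => //=.
  - have := @lebesgue_rV_box n.+1 0 r (ltW r0).
    by rewrite /= /lebesgue_rV_step /pushforward/= => ->; rewrite ltry.
  - by move=> z; exact: hB.
  - by move=> z; exact: dF0.
rewrite /= /lebesgue_rV_step integral_pushforward//=; last first.
  exact/measurable_EFinP.
rewrite preimage_setT.
case: (unliftP ord0 i) => [j ij|i0]; subst i.
- rewrite -integral12_prod_meas1//= /fubini_F/=.
  rewrite integral0_eq// => s _.
  apply: (IH j (fun w => F (rVcons (s, w))) (fun w => dF (rVcons (s, w)))).
  + by move=> w; apply: continuous_comp; [exact: continuous_rVcons|exact: cdF].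
  + move=> w; apply: is_derive_line (dFE (rVcons (s, w))) => h.
    by rewrite -rVcons_deltaS -rVconsD add0r.
  + by move=> w hw; apply: F0 => /box_rVcons; rewrite btail => -[].
  + by move=> w hw; apply: dF0 => /box_rVcons; rewrite btail => -[].
- rewrite -integral21_prod_meas1//= /fubini_G/=.
  rewrite integral0_eq// => w _.
  apply: (integral_derive1_eq0 (fun s => F (rVcons (s, w)))
    (fun s => dF (rVcons (s, w))) r r0).
  + by move=> s; apply: continuous_comp; [exact: continuous_rVcons1|exact: cdF].
  + move=> s; apply: is_derive_line (dFE (rVcons (s, w))) => h.
    by rewrite -rVcons_delta0 -rVconsD add0r [h *: 1]mulr1.
  + by move=> s hs; apply: F0 => /box_rVcons;
    rewrite bhead subr0 leNgt hs => -[].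
  + by move=> s hs; apply: dF0 => /box_rVcons;
    rewrite bhead subr0 leNgt hs => -[].
Qed.

End rV_measure.

(** * Integration by parts and weak derivatives of separable sums *)

Section integration_by_parts.
Context {R : realType} {d : nat}.
Local Notation V := 'rV[R]_d.
Local Notation mu := (@lebesgue_rV R d).
Local Notation oc := (@open_cube R d).

Lemma cube_box : cube d = box 0 1 :> set V.
Proof.
by apply/seteqP; split => x /= h i; have := h i; rewrite mxE subr0 -ler_norml.
Qed.

Lemma open_cube_box : oc `<=` (box 0 1 : set V).
Proof. by rewrite -cube_box => x h i; have /andP[/ltW-> /ltW->] := h i. Qed.

Lemma Rintegral_support (A : set V) (f : V -> R) :
  (forall x, ~ A x -> f x = 0) ->
  \int[mu]_(x in A) f x = \int[mu]_x f x.
Proof.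
move=> f0; rewrite Rintegral_mkcond; apply: eq_Rintegral => x _.
by rewrite patchE; case: ifPn => //; rewrite notin_setE => /f0 ->.
Qed.

(** The product u * w vanishes outside the cube, so its partial derivative has
    integral zero. *)
Lemma Rintegral_by_parts (i : 'I_d) (u du w dw : V -> R) :
  continuous u -> continuous du -> continuous w -> continuous dw ->
  (forall x, is_derive x (delta_mx 0 i) u (du x)) ->
  (forall x, is_derive x (delta_mx 0 i) w (dw x)) ->
  (forall x, ~ oc x -> w x = 0) ->
  (forall x, ~ oc x -> dw x = 0) ->
  \int[mu]_(x in oc) (u x * dw x) =
  - \int[mu]_(x in oc) (du x * w x).
Proof.
move=> cu cdu cw cdw uE wE w0 dw0.
rewrite (Rintegral_support oc (fun x => u x * dw x)); last first.
  by move=> x /dw0 ->; rewrite mulr0.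
rewrite (Rintegral_support oc (fun x => du x * w x)); last first.
  by move=> x /w0 ->; rewrite mulr0.
have nbox (x : V) : ~ box 0 1 x -> ~ oc x by move=> h /open_cube_box.
have mb := @measurable_box R d 0 1.
have mb1 : (mu (box 0 1) < +oo)%E by rewrite lebesgue_rV_box// ltry.
have int_ct (f : V -> R) : continuous f -> (forall x, ~ oc x -> f x = 0) ->
    mu.-integrable setT (EFin \o f).
  move=> cf f0; have [B _ hB] := @continuous_bounded_box _ _ f 0 1 cf.
  apply: (@integrable_bounded_support _ _ _ _ _ f B mb mb1) => //.
    exact: continuous_measurable_rV.
  by move=> x /nbox; exact: f0.
have cM (f g : V -> R) : continuous f -> continuous g ->
    continuous (fun x => f x * g x).
  by move=> cf cg0 x; apply: (continuousM (cf x) (cg0 x)).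
apply/eqP; rewrite -addr_eq0 -RintegralD//; last 2 first.
- by apply: int_ct => [|x /dw0 ->]; [exact: cM|rewrite mulr0].
- by apply: int_ct => [|x /w0 ->]; [exact: cM|rewrite mulr0].
have H : (\int[mu]_x (u x * dw x + du x * w x)%:E = 0)%E.
  apply: (@integral_partial_eq0 _ _ i (fun x => u x * w x) _ 1) => //.
  - by move=> x; apply: (continuousD (cM _ _ cu cdw x) (cM _ _ cdu cw x)).
  - move=> x; have h := is_deriveM (uE x) (wE x).
    by apply: (is_derive_eq h); rewrite [w x *: _]mulrC.
  - by move=> x /nbox/w0 ->; rewrite mulr0.
  - by move=> x /nbox nx; rewrite w0// dw0// !mulr0 addr0.
by rewrite /Rintegral H.
Qed.

Section test_functions.
Variable phi : V -> R.
Hypothesis tphi : test_function phi.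

(** The complement of the support is open, so the function is constantly zero
    around each of its points. *)
Lemma test_iter_partial_out (s : seq 'I_d) (x : V) :
  ~ closure [set x | phi x != 0] x -> foldr (@partial R d) phi s x = 0.
Proof.
elim: s x => [|i s IH] x nx /=.
  by apply/eqP; apply: contra_notT nx => h; exact: subset_closure.
rewrite /partial (@near_eq_derive _ _ _ _ (cst 0)) ?derive_cst//.
have oC : open (~` closure [set x | phi x != 0]).
  by rewrite openC; exact: closed_closure.
have : nbhs x (~` closure [set x | phi x != 0]) by exact: open_nbhs_nbhs.
by apply: filterS => y /IH.
Qed.

Lemma test_iter_partial0 (s : seq 'I_d) (x : V) :
  ~ oc x -> foldr (@partial R d) phi s x = 0.
Proof. by case: tphi => _ _ sub nx; apply: test_iter_partial_out => /sub. Qed.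

Lemma test_is_derive (s : seq 'I_d) (i : 'I_d) (x : V) :
  is_derive x (delta_mx 0 i) (foldr (@partial R d) phi s)
    (foldr (@partial R d) phi (i :: s) x).
Proof.
by case: tphi => sm _ _; apply/derivableP/diff_derivable; exact: sm.
Qed.

Lemma test_continuous (s : seq 'I_d) : continuous (foldr (@partial R d) phi s).
Proof.
by case: tphi => sm _ _ x; apply/differentiable_continuous; exact: sm.
Qed.

End test_functions.

Definition incr (i : 'I_d) (e : 'I_d -> nat) : 'I_d -> nat :=
  fun l => ((i == l) + e l)%N.

Section separable_sum.
Context {K : finType} (c : K -> R) (g : K -> 'I_d -> nat -> R -> R) (r : nat).
Hypothesis gE : forall k i j (s : R), (j < r)%N ->
  is_derive s 1 (g k i j) (g k i j.+1 s).
Hypothesis cg : forall k i j, (j <= r)%N -> continuous (g k i j).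

(** [g k i j] stands for the [j]-th derivative of the [i]-th factor of the
    [k]-th term. A partial derivative in direction [i] then only increments
    [e i], and the family of all [sepsum e] is closed under differentiation. *)
Definition sepsum (e : 'I_d -> nat) (x : V) : R :=
  \sum_k c k * \prod_i g k i (e i) (x 0 i).

Lemma continuous_sepsum e : (forall i, e i <= r)%N -> continuous (sepsum e).
Proof.
move=> er.
have cadd : continuous (fun z : R * R => z.1 + z.2) by exact: add_continuous.
have cmul : continuous (fun z : R * R => z.1 * z.2) by exact: mul_continuous.
apply: (continuous_big cadd) => k _.
have cp : continuous (fun x : V => \prod_i g k i (e i) (x 0 i)); last first.
  by move=> x; apply: (continuousM (@cst_continuous _ _ (c k) x) (cp x)).
apply: (continuous_big cmul) => i _ x;
  apply: (@continuous_comp _ _ _ (fun x : V => x 0 i)).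
  exact: coord_continuous.
exact: cg.
Qed.

Lemma is_derive_big (V' : normedModType R) (x v : V') (F dF :
  K -> V' -> R) (s : seq K) :
  (forall k, is_derive x v (F k) (dF k x)) ->
  is_derive x v (fun y => \sum_(k <- s) F k y) (\sum_(k <- s) dF k x).
Proof.
move=> FE; elim: s => [|k s IH].
  rewrite big_nil (_ : (fun _ => _) = cst 0); first exact: is_derive_cst.
  by apply/funext => y; rewrite big_nil.
rewrite big_cons (_ : (fun _ => _) = F k + (fun y => \sum_(k <- s) F k y)).
  exact: is_deriveD.
by apply/funext => y; rewrite big_cons.
Qed.

Lemma is_derive_sepsum e (i : 'I_d) (x : V) : (e i < r)%N ->
  is_derive x (delta_mx 0 i) (sepsum e) (sepsum (incr i e) x).
Proof.
move=> er.
pose P k := c k * \prod_(l | l != i) g k l (e l) (x 0 l).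
pose G s := \sum_k P k * g k i (e i) s.
have GE : is_derive (x 0 i) 1 G (\sum_k P k * g k i (e i).+1 (x 0 i)).
  apply: (is_derive_big R^o (x 0 i) (1 : R) (fun k s => P k * g k i (e i) s)
    (fun k s => P k * g k i (e i).+1 s)) => k.
  apply: (@is_deriveZ _ _ _ (g k i (e i)) (P k)).
  exact: gE.
rewrite (_ : sepsum _ x = \sum_k P k * g k i (e i).+1 (x 0 i)).
  apply: is_derive_line GE => h; apply: eq_bigr => k _.
  rewrite (bigD1 i)//= -mulrA; congr (_ * _).
  rewrite mulrC !mxE !eqxx; congr (_ * _).
  apply: eq_bigr => l li; congr (g _ _ _ _).
  by rewrite !mxE (negbTE li) andbF mulr0 add0r.
apply: eq_bigr => k _; rewrite (bigD1 i)//= -mulrA; congr (_ * _).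
rewrite mulrC /incr eqxx; congr (_ * _).
by apply: eq_bigr => l; rewrite eq_sym => /negbTE ->.
Qed.

(** Partial derivatives are moved from the test function to the sum one by one,
    from the outermost inwards. *)
Lemma sepsum_by_parts phi (s : seq 'I_d) (e : 'I_d -> nat) :
  test_function phi -> (forall i, count_mem i s + e i <= r)%N ->
  \int[mu]_(x in oc) (sepsum e x * foldr (@partial R d) phi s x) =
  (-1) ^+ size s *
  \int[mu]_(x in oc) (sepsum (fun i => count_mem i s + e i)%N x * phi x).
Proof.
move=> tphi; elim: s e => [|i s IH] e er; first by rewrite mul1r.
have er' l : (count_mem l s + incr i e l <= r)%N.
  by have := er l; rewrite /incr /= addnA [(_ + (i == l))%N]addnC.
have -> : \int[mu]_(x in oc) (sepsum e x * foldr (@partial R d) phi (i :: s) x)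
  =
    - \int[mu]_(x in oc) (sepsum (incr i e) x * foldr (@partial R d) phi s x).
  apply: (@Rintegral_by_parts i).
  - by apply: continuous_sepsum => l; rewrite (leq_trans _ (er l))// leq_addl.
  - by apply: continuous_sepsum => l; rewrite (leq_trans _ (er' l))// leq_addl.
  - exact: test_continuous.
  - exact: test_continuous.
  - move=> x; apply: is_derive_sepsum.
    by rewrite (leq_trans _ (er i))//= eqxx add1n addSn ltnS leq_addl.
  - by move=> x; exact: test_is_derive.
  - by move=> x; exact: test_iter_partial0.
  - by move=> x; exact: test_iter_partial0.
rewrite IH//= exprS mulN1r mulNr; congr (- (_ * _)).
apply: eq_Rintegral => x _; congr (sepsum _ _ * _); apply/funext => l.
by rewrite /incr addnA [(_ + (i == l))%N]addnC.
Qed.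

Lemma continuous_locally_integrable (f : V -> R) :
  continuous f -> locally_integrable_cube f.
Proof.
move=> cf; have mf := continuous_measurable_rV _ _ cf.
split; first exact: measurable_funTS.
move=> A cA Asub.
have mA : measurable A.
  rewrite -[A]setCK; apply: measurableC; apply: open_measurable_rV.
  by rewrite openC; apply: compact_closed => //; exact: norm_hausdorff.
have [B _ hB] := @continuous_bounded_box _ _ f 0 1 cf.
apply: measurable_bounded_integrable => //.
- have le1 : (mu A <= mu (box 0 1))%E.
    apply: le_measure; rewrite ?inE//; first exact: measurable_box.
    exact: subset_trans Asub open_cube_box.
  by rewrite (le_lt_trans le1)// lebesgue_rV_box// ltry.
- exact: measurable_funTS.
- exists B; split; first exact: num_real.
  by move=> x Bx y Ay; apply: (le_trans (hB _ _) (ltW Bx));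
    exact/open_cube_box/Asub.
Qed.

Lemma mi_partialE (gamma : multi_index d r) (phi : V -> R) :
  mi_partial gamma phi =
  foldr (@partial R d) phi (flatten [seq nseq (gamma i) i | i <- enum 'I_d]).
Proof.
rewrite /mi_partial; elim: (enum _) => //= i s ->.
by rewrite foldr_cat; elim: (nat_of_ord (gamma i)) => //= n ->.
Qed.

(** Only derivatives of order at most [r] of each factor are ever used, so
    factors of finite smoothness suffice. *)
Lemma weak_derivative_sepsum (gamma : multi_index d r) :
  weak_derivative gamma (sepsum (fun=> 0%N)) (sepsum (fun i => gamma i)).
Proof.
have gr i : (gamma i <= r)%N by rewrite -ltnS.
split.
- by apply: continuous_locally_integrable; exact: continuous_sepsum.
- by apply: continuous_locally_integrable; exact: continuous_sepsum.
move=> phi tphi; rewrite mi_partialE.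
set s := flatten _.
have cs i : count_mem i s = gamma i.
  rewrite /s count_flatten -map_comp sumnE big_map big_enum /= (bigD1 i)//=.
  rewrite count_nseq /= eqxx mul1n big1 ?addn0// => j ji.
  by rewrite count_nseq /= (negbTE ji).
have ss : size s = mi_length gamma.
  rewrite /s size_flatten /shape -map_comp sumnE big_map big_enum /=.
  by apply: eq_bigr => i _; rewrite /= size_nseq.
rewrite sepsum_by_parts//; last by move=> i; rewrite cs addn0.
rewrite ss; congr (_ * _); apply: eq_Rintegral => x _.
by congr (sepsum _ _ * _); apply/funext => i; rewrite cs addn0.
Qed.

End separable_sum.
End integration_by_parts.

(** * A polynomial bump on the unit interval *)

(** A derivative lowers the multiplicity of a root by at most one. *)
Lemma derivn_exp_factor (R : comNzRingType) (q : {poly R}) (n j : nat) :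
  (j <= n)%N -> exists p, (q ^+ n)^`(j) = p * q ^+ (n - j).
Proof.
elim: j => [_|j IH jn]; first by exists 1; rewrite derivn0 subn0 mul1r.
have [p E] := IH (ltnW jn); rewrite derivnS E derivM deriv_exp.
rewrite subnS; case: (n - j)%N (subn_gt0 j n) => [|k]; first by rewrite jn.
move=> _ /=; exists (p^`() * q + p * (q^`() *+ k.+1)).
by rewrite exprS /= -[_ *+ k.+1]mulr_natr -[q^`() *+ _]mulr_natr; ring.
Qed.

(** The factors are exchanged one at a time. *)
Lemma ler_dist_prod (R : realFieldType) (I : Type) (s : seq I) (a b : I -> R)
    (B : R) : 1 <= B -> (forall i, `|a i| <= B) -> (forall i, `|b i| <= B) ->
  `|\prod_(i <- s) a i - \prod_(i <- s) b i| <=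
  B ^+ size s * \sum_(i <- s) `|a i - b i|.
Proof.
move=> B1 aB bB; have B0 : 0 <= B by lra.
elim: s => [|i s IH]; first by rewrite !big_nil subrr normr0 mulr0.
rewrite !big_cons.
have -> : a i * \prod_(j <- s) a j - b i * \prod_(j <- s) b j =
   (a i - b i) * \prod_(j <- s) a j +
   b i * (\prod_(j <- s) a j - \prod_(j <- s) b j) by ring.
rewrite (le_trans (ler_normD _ _))// !normrM /= mulrDr lerD//.
  rewrite mulrC ler_wpM2r// normr_prod exprS.
  apply: (@le_trans _ _ (1 * B ^+ size s));
    last by rewrite ler_wpM2r// exprn_ge0.
  rewrite mul1r; elim: s {IH} => [|j s IH]; first by rewrite big_nil.
  by rewrite big_cons /= exprS ler_pM// prodr_ge0.
by rewrite exprS -mulrA ler_pM.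
Qed.

Section bump.
Context {R : realType} (r : nat).

(** At [x] every difference quotient of [f] is one of [g1] or one of [g2]. *)
Lemma is_derive_glue (f g1 g2 : R -> R) (x l : R) :
  (forall y, f y = g1 y \/ f y = g2 y) -> g1 x = f x -> g2 x = f x ->
  is_derive x 1 g1 l -> is_derive x 1 g2 l -> is_derive x 1 f l.
Proof.
move=> fg g1x g2x [d1 E1] [d2 E2].
have q1 : (fun h => h^-1 *: ((g1 \o shift x) (h *: (1:R)) - g1 x)) @ 0^' --> l.
  by rewrite -E1; exact: d1.
have q2 : (fun h => h^-1 *: ((g2 \o shift x) (h *: (1:R)) - g2 x)) @ 0^' --> l.
  by rewrite -E2; exact: d2.
have q : (fun h => h^-1 *: ((f \o shift x) (h *: (1:R)) - f x)) @ 0^' --> l.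
  apply/cvgrPdist_lt => e e0.
  have /cvgrPdist_lt/(_ e e0) n1 := q1.
  have /cvgrPdist_lt/(_ e e0) n2 := q2.
  near=> h => /=; have [->|->] := fg (h *: (1:R) + x).
    by rewrite -g1x; near: h; exact: n1.
  by rewrite -g2x; near: h; exact: n2.
constructor; first by apply/cvg_ex; exists l.
exact/cvg_lim.
Unshelve. all: by end_near. Qed.

(** With exponent [r.+2] the derivatives of order at most [r.+1] vanish at 0 and
    at 1. Hence the extension by zero has [r] continuous derivatives, the last
    of which is Lipschitz. *)
Definition bump_poly : {poly R} := ('X * (1 - 'X)) ^+ r.+2.

(** The [j]-th derivative, for [j <= r.+1], of a bump supported in the unit
    interval; the bump itself is the case [j = 0]. *)
Definition poly_bump (j : nat) (s : R) : R :=
  if 0 <= s <= 1 then bump_poly^`(j).[s] else 0.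

Lemma bump_poly_root j s : (j <= r.+1)%N -> s = 0 \/ s = 1 ->
  bump_poly^`(j).[s] = 0.
Proof.
move=> jr s01.
have [p ->] : exists p, bump_poly^`(j) = p * ('X * (1 - 'X)) ^+ (r.+2 - j).
  by apply: derivn_exp_factor; rewrite leqW.
have q0 : ('X * (1 - 'X) : {poly R}).[s] = 0.
  by rewrite !hornerE; case: s01 => ->; rewrite ?subrr ?mul0r ?mulr0.
by rewrite subSn// exprS mulrA hornerM hornerM q0 mulr0 mul0r.
Qed.

Lemma bump_neq0 j s : (j <= r.+1)%N -> poly_bump j s != 0 -> 0 < s < 1.
Proof.
rewrite /poly_bump => jr; case: ifP => [/andP[]|]; last by rewrite eqxx.
rewrite le_eqVlt => /orP[/eqP <-|s0].
  by rewrite bump_poly_root ?eqxx//; left.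
rewrite le_eqVlt => /orP[/eqP ->|s1 _]; last by rewrite s0.
by rewrite bump_poly_root ?eqxx//; right.
Qed.

Lemma is_derive_bump j (s : R) :
  (j <= r)%N -> is_derive s 1 (poly_bump j) (poly_bump j.+1 s).
Proof.
move=> jr.
have dP : is_derive s 1 (horner bump_poly^`(j)) bump_poly^`(j.+1).[s].
  by rewrite derivnS; exact: is_derive_poly.
have d0 : is_derive s 1 (cst 0 : R -> R) 0 by exact: is_derive_cst.
have inI : 0 < s < 1 -> is_derive s 1 (poly_bump j) (poly_bump j.+1 s).
  move=> /andP[s0 s1]; rewrite {2}/poly_bump !ltW//=.
  apply: near_eq_is_derive dP; near=> y; rewrite /poly_bump ifT//.
  by apply/andP; split; apply: ltW; near: y; [exact: lt_nbhsr|exact: lt_nbhsl].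
have [s0|s0|s0] := ltgtP s 0.
- rewrite {2}/poly_bump leNgt s0/=; apply: near_eq_is_derive d0; near=> y.
  rewrite /poly_bump leNgt ifF//=; apply/negbTE; rewrite negb_and negbK;
    apply/orP; left.
  by near: y; exact: lt_nbhsl.
- have [s1|s1|s1] := ltgtP s 1; first by apply: inI; rewrite s0.
    rewrite {2}/poly_bump [s <= 1]leNgt s1 andbF/=;
      apply: near_eq_is_derive d0; near=> y.
    rewrite /poly_bump [y <= 1]leNgt ifF//=; apply/negbTE;
      rewrite negb_and negbK; apply/orP; right.
    by near: y; exact: lt_nbhsr.
  have h0 k : (k <= r.+1)%N -> bump_poly^`(k).[s] = 0.
    by move=> kr; apply: bump_poly_root => //; right.
  have b0 k : (k <= r.+1)%N -> poly_bump k s = 0.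
    by move=> kr; rewrite /poly_bump h0//; case: ifP.
  rewrite b0//; rewrite h0// in dP.
  apply: (is_derive_glue _ _ _ _ _ _ _ _ dP d0).
  + by move=> y; rewrite /poly_bump; case: ifP; [left|right].
  + by rewrite b0 ?h0// leqW.
  + by rewrite b0// leqW.
- have h0 k : (k <= r.+1)%N -> bump_poly^`(k).[s] = 0.
    by move=> kr; apply: bump_poly_root => //; left.
  have b0 k : (k <= r.+1)%N -> poly_bump k s = 0.
    by move=> kr; rewrite /poly_bump h0//; case: ifP.
  rewrite b0//; rewrite h0// in dP.
  apply: (is_derive_glue _ _ _ _ _ _ _ _ dP d0).
  + by move=> y; rewrite /poly_bump; case: ifP; [left|right].
  + by rewrite b0 ?h0// leqW.
  + by rewrite b0// leqW.
Unshelve. all: by end_near. Qed.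

Lemma continuous_bump j : (j <= r)%N -> continuous (poly_bump j).
Proof.
move=> jr s; apply/differentiable_continuous/derivable1_diffP.
by have [] := is_derive_bump j s jr.
Qed.

Lemma bump_half : 0 < poly_bump 0 2^-1.
Proof.
rewrite /poly_bump ifT; last by apply/andP; split; lra.
rewrite derivn0 /bump_poly !hornerE exprn_gt0//; lra.
Qed.

(** On the unit interval a polynomial is bounded by the sum of the absolute
    values of its coefficients. *)
Lemma bump_bounded : exists2 B : R, 1 <= B &
  forall j s, (j <= r.+1)%N -> `|poly_bump j s| <= B.
Proof.
pose N (j : nat) : R := \sum_(i < size bump_poly^`(j)) `|bump_poly^`(j)`_i|.
have N0 j : 0 <= N j by apply: sumr_ge0.
exists (1 + \sum_(j < r.+2) N j); first by rewrite lerDl; apply: sumr_ge0.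
move=> j s jr; rewrite /poly_bump; case: ifP => [/andP[s0 s1]|_]; last first.
  by rewrite normr0 addr_ge0//; apply: sumr_ge0.
have jr' : (j < r.+2)%N by [].
rewrite (bigD1 (Ordinal jr'))//= horner_coef.
have : `|\sum_(i < size bump_poly^`(j)) bump_poly^`(j)`_i * s ^+ i| <= N j.
  rewrite (le_trans (ler_norm_sum _ _ _))//; apply: ler_sum => i _.
  rewrite normrM -[leRHS]mulr1 ler_wpM2l// ger0_norm ?exprn_ge0//.
  by rewrite exprn_ile1.
have : 0 <= \sum_(i < r.+2 | i != Ordinal jr') N i by apply: sumr_ge0.
lra.
Qed.

Lemma bump_lipschitz (B : R) :
  (forall j s, (j <= r.+1)%N -> `|poly_bump j s| <= B) ->
  forall j s t, (j <= r)%N -> `|poly_bump j s - poly_bump j t| <= B * `|s - t|.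
Proof.
move=> hB j s t jr; wlog st : s t / t <= s.
  move=> H; have [/H//|/ltW/H] := leP t s.
  by rewrite distrC [`|t - s|]distrC.
have [||x _ ->] := @MVT_segment R (poly_bump j) (poly_bump j.+1) t s st.
- by move=> x _; exact: is_derive_bump.
- by apply: continuous_subspaceT; exact: continuous_bump.
- by rewrite normrM ler_wpM2r// hB.
Qed.

End bump.

(** * Sums of bumps over a grid *)

Lemma ler_coord_euclidean (R : realType) (d : nat) (x : 'rV[R]_d) i :
  `|x 0 i| <= euclidean_norm x.
Proof.
rewrite /euclidean_norm -sqrtr_sqr ler_wsqrtr// (bigD1 i)//= lerDl.
by apply: sumr_ge0 => j _; exact: sqr_ge0.
Qed.

Section bump_sums.
Context {R : realType} (d r m : nat).
Local Notation V := 'rV[R]_d.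
Local Notation cell := {ffun 'I_d -> 'I_m}.

Definition local_coord (k : cell) (x : V) (i : 'I_d) : R :=
  m%:R * x 0 i - (k i)%:R.

(** The power of [m] is the one that the chain rule produces. *)
Definition cell_factor (k : cell) (i : 'I_d) (j : nat) (s : R) : R :=
  m%:R ^+ j * poly_bump r j (m%:R * s - (k i)%:R).

Lemma is_derive_cell_factor k i j (s : R) : (j <= r)%N ->
  is_derive s 1 (cell_factor k i j) (cell_factor k i j.+1 s).
Proof.
move=> jr.
have g' : is_derive s 1 (fun s : R => m%:R * s - (k i)%:R) m%:R.
  have h := is_deriveB (is_deriveZ (m%:R : R) (is_derive_id s (1 : R)))
    (is_derive_cst ((k i)%:R : R) s (1 : R)).
  by apply: (is_derive_eq h); rewrite subr0 [_ *: _]mulr1.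
have b' : is_derive (m%:R * s - (k i)%:R) 1 (poly_bump r j) (poly_bump r j.+1
  (m%:R * s - (k i)%:R)).
  exact: is_derive_bump.
have h := is_deriveZ (m%:R ^+ j : R) 
  (@is_derive1_comp R (poly_bump r j) (fun s => m%:R * s - (k i)%:R) s _ _ b'
    g').
by apply: (is_derive_eq h); rewrite /cell_factor exprS /GRing.scale /=; ring.
Qed.

Lemma continuous_cell_factor k i j :
  (j <= r)%N -> continuous (cell_factor k i j).
Proof.
move=> jr s; apply/differentiable_continuous/derivable1_diffP.
by have [] := is_derive_cell_factor k i j s jr.
Qed.

Definition in_cell (k : cell) (x : V) : bool :=
  [forall i, 0 < local_coord k x i < 1].

Lemma in_cell_inj k k' x : in_cell k x -> in_cell k' x -> k = k'.
Proof.
move=> /forallP h /forallP h'; apply/ffunP => i; apply/val_inj => /=.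
have /andP[a1 a2] := h i; have /andP[b1 b2] := h' i.
rewrite /local_coord in a1 a2 b1 b2.
have l1 : (k i)%:R < (k' i).+1%:R :> R by rewrite -natr1; lra.
have l2 : (k' i)%:R < (k i).+1%:R :> R by rewrite -natr1; lra.
rewrite !ltr_nat !ltnS in l1 l2.
by apply/eqP; rewrite eqn_leq l1.
Qed.

(** The open cells are disjoint. Every estimate on a sum of bumps below is
    uniform in the number of cells for this reason. *)
Lemma sum_in_cell x : \sum_k (in_cell k x)%:R <= 1 :> R.
Proof.
have [/existsP[k hk]|/existsPn h] := boolP [exists k, in_cell k x].
  rewrite (bigD1 k)//= hk big1 ?addr0// => k' kk'.
  by case: (boolP (in_cell k' x)) => // /(in_cell_inj _ _ _ hk)/esym/eqP;
    rewrite (negbTE kk').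
by rewrite big1// => k _; rewrite (negbTE (h k)).
Qed.

Lemma sepsum_cell_factor (c : cell -> R) e x : sepsum c cell_factor e x =
  m%:R ^+ (\sum_i e i) * \sum_k c k * \prod_i poly_bump r (e i) (local_coord k
    x i).
Proof.
rewrite /sepsum mulr_sumr; apply: eq_bigr => k _.
by rewrite big_split /= -prodrXr mulrCA.
Qed.

Section bounds.
Variable (B : R).
Hypotheses (B1 : 1 <= B)
  (hB : forall j s, (j <= r.+1)%N -> `|poly_bump r j s| <= B).
Variable (e : 'I_d -> nat).
Hypothesis er : forall i, (e i <= r)%N.

Let B0 : 0 <= B. Proof. exact: le_trans B1. Qed.

Let F (k : cell) (x : V) := \prod_i poly_bump r (e i) (local_coord k x i).

Lemma bump_prod_out k x : ~~ in_cell k x -> F k x = 0.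
Proof.
rewrite negb_forall => /existsP[i hi]; rewrite /F (bigD1 i)//=.
suff -> : poly_bump r (e i) (local_coord k x i) = 0 by rewrite mul0r.
by apply/eqP; apply: contraNT hi; apply: bump_neq0; rewrite leqW.
Qed.

Lemma bump_prod_le k x : `|F k x| <= B ^+ d * (in_cell k x)%:R.
Proof.
have [_|/bump_prod_out->] := boolP (in_cell k x); last by rewrite normr0 mulr0.
rewrite mulr1 normr_prod -[leRHS](_ : \prod_(i < d) B = _); last first.
  by rewrite prodr_const card_ord.
by apply: ler_prod => i _; rewrite normr_ge0 hB// leqW.
Qed.

Let A := 2 * d.+1%:R * B ^+ d.+1.

(** Points closer than 1/m are compared by the Lipschitz bound, the others by
    the sup bound. The two indicators record that a bump is zero at both points
    unless its cell contains one of them. *)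
Lemma bump_prod_dist k x y : `|F k x - F k y| <=
  A * Num.min 1 (m%:R * euclidean_norm (x - y)) *
  ((in_cell k x)%:R + (in_cell k y)%:R).
Proof.
have rho0 : 0 <= euclidean_norm (x - y) by exact: sqrtr_ge0.
have Bd0 : 0 <= B ^+ d by exact: exprn_ge0.
have Bd : B ^+ d <= B ^+ d.+1 by rewrite exprS ler_peMl.
have dist1 : `|F k x - F k y| <= A.
  have := bump_prod_le k x; have := bump_prod_le k y.
  have i1 (b : bool) : B ^+ d * b%:R <= B ^+ d.+1.
    by case: b; rewrite ?mulr1// mulr0 exprn_ge0.
  move=> /le_trans/(_ (i1 _)) hy /le_trans/(_ (i1 _)) hx.
  rewrite (le_trans (ler_normB _ _))//.
  have : 2 * B ^+ d.+1 <= A.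
    rewrite /A mulrAC ler_peMr ?ler1n// mulr_ge0// exprn_ge0//.
  lra.
have dist2 : `|F k x - F k y| <= A * (m%:R * euclidean_norm (x - y)).
  have bx z i : `|poly_bump r (e i) (local_coord k z i)| <= B by rewrite hB//
    leqW.
  rewrite (le_trans (@ler_dist_prod _ _ _ _ _ B B1 (bx x) (bx y)))//.
  have -> : size (index_enum 'I_d) = d
    by rewrite -[index_enum _]enumT size_enum_ord.
  have h i : `|poly_bump r (e i) (local_coord k x i) - poly_bump r (e i)
    (local_coord k y i)|
      <= B * (m%:R * euclidean_norm (x - y)).
    rewrite (le_trans (bump_lipschitz _ _ hB _ _ _ (er i)))// ler_wpM2l//.
    have -> : local_coord k x i - local_coord k y i = m%:R * ((x - y) 0 i).
      by rewrite /local_coord !mxE; ring.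
    by rewrite normrM ger0_norm// ler_wpM2l// ler_coord_euclidean.
  have : \sum_i `|poly_bump r (e i) (local_coord k x i) -
      poly_bump r (e i) (local_coord k y i)| <=
      \sum_(i < d) B * (m%:R * euclidean_norm (x - y)).
    by apply: ler_sum => i _; exact: h.
  rewrite sumr_const card_ord => hs.
  rewrite (le_trans (ler_wpM2l Bd0 hs))// /A exprS.
  have E0 : 0 <= B * B ^+ d * (m%:R * euclidean_norm (x - y))
    by rewrite !mulr_ge0.
  rewrite -mulr_natr -[d.+1%:R]natr1.
  have : 0 <= d%:R * (B * B ^+ d * (m%:R * euclidean_norm (x - y)))
    by rewrite mulr_ge0.
  nra.
have dist : `|F k x - F k y| <= A * Num.min 1 (m%:R * euclidean_norm (x - y)).
  by rewrite minEle; case: ifP => _; rewrite ?mulr1.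
have A0 : 0 <= A * Num.min 1 (m%:R * euclidean_norm (x - y)).
  exact: le_trans dist.
have [hx|/bump_prod_out hx] := boolP (in_cell k x).
  by rewrite (le_trans dist)// ler_peMr// lerDl ler0n.
have [hy|/bump_prod_out hy] := boolP (in_cell k y).
  by rewrite (le_trans dist)// add0r mulr1.
by rewrite hx hy subrr normr0 addr0 mulr0.
Qed.

Variables (c : cell -> R) (C : R).
Hypothesis cC : forall k, `|c k| <= C.

Lemma sepsum_bump_le x : 0 <= C ->
  `|sepsum c cell_factor e x| <= 2 * A * C * m%:R ^+ (\sum_i e i).
Proof.
move=> C0.
rewrite sepsum_cell_factor normrM ger0_norm ?exprn_ge0//
  mulrC ler_wpM2r ?exprn_ge0//.
have : `|\sum_k c k * F k x| <= \sum_k C * B ^+ d * (in_cell k x)%:R.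
  rewrite (le_trans (ler_norm_sum _ _ _))//; apply: ler_sum => k _.
  by rewrite normrM -mulrA ler_pM// bump_prod_le.
rewrite -mulr_sumr => /le_trans; apply.
have CB0 : 0 <= C * B ^+ d by rewrite mulr_ge0// exprn_ge0.
rewrite (le_trans (ler_wpM2l CB0 (sum_in_cell x)))//
  mulr1 /A exprS mulrC ler_wpM2r//.
have b0 : 0 <= B ^+ d by rewrite exprn_ge0.
have : 1 <= d.+1%:R :> R by rewrite ler1n.
have : B ^+ d <= B * B ^+ d by rewrite ler_peMl.
nra.
Qed.

Lemma sepsum_bump_dist x y : 0 <= C ->
  `|sepsum c cell_factor e x - sepsum c cell_factor e y| <=
  2 * A * C * m%:R ^+ (\sum_i e i) * Num.min 1 (m%:R * euclidean_norm (x - y)).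
Proof.
move=> C0; rewrite !sepsum_cell_factor -mulrBr normrM ger0_norm ?exprn_ge0//.
rewrite [leRHS](_ : _ = m%:R ^+ (\sum_i e i) *
  (C * (A * Num.min 1 (m%:R * euclidean_norm (x - y))) * 2)); last by ring.
rewrite ler_wpM2l ?exprn_ge0// -sumrB.
set D := A * _.
have D0 : 0 <= D.
  rewrite /D /A !mulr_ge0 ?exprn_ge0// le_min ler01 mulr_ge0// sqrtr_ge0//.
apply: (@le_trans _ _ (\sum_k C * D * ((in_cell k x)%:R + (in_cell k y)%:R))).
  rewrite (le_trans (ler_norm_sum _ _ _))//; apply: ler_sum => k _.
  by rewrite -mulrBr normrM -mulrA ler_pM// bump_prod_dist.
have CD0 : 0 <= C * D by exact: mulr_ge0.
rewrite -mulr_sumr (ler_wpM2l CD0)// big_split /=.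
by have := sum_in_cell x; have := sum_in_cell y; lra.
Qed.

End bounds.
End bump_sums.

(** * Integrals near the diagonal *)

Section integral_monotone.
Import HBNNSimple.

(** The integral of a nonnegative function is the supremum of the integrals of
    the simple functions below it, so it is monotone without any measurability. *)
Lemma ge0_le_integral_nomeas d (T : measurableType d) (R : realType)
    (mu : {measure set T -> \bar R}) (f g : T -> \bar R) :
  (forall x, 0 <= f x)%E -> (forall x, f x <= g x)%E ->
  (\int[mu]_x f x <= \int[mu]_x g x)%E.
Proof.
move=> f0 fg; have g0 x : (0 <= g x)%E := le_trans (f0 x) (fg x).
rewrite !ge0_integralTE//; apply: ereal_sup_le => _ [h hf <-].
by exists h => // x; exact: le_trans (hf x) (fg x).
Qed.

End integral_monotone.

Lemma sum_geometric_le (R : realFieldType) (w : R) n : 0 <= w < 1 ->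
  \sum_(i < n) w ^+ i <= (1 - w)^-1.
Proof.
move=> /andP[w0 w1]; have w1' : 0 < 1 - w by lra.
rewrite -(ler_pM2l w1') divff ?gt_eqF//.
have := subrX1 w n; have : 0 <= w ^+ n by exact: exprn_ge0.
nra.
Qed.

Section band.
Context {R : realType} {d : nat}.
Local Notation V := 'rV[R]_d.
Local Notation mu := (@lebesgue_rV R d).

Definition band (s : R) : set (V * V) :=
  [set z | [/\ cube d z.1, cube d z.2 & forall i, `|z.1 0 i - z.2 0 i| <= s]].

Lemma measurable_cube : measurable (cube d : set V).
Proof. by rewrite cube_box; exact: measurable_box. Qed.

Lemma measurable_band s : measurable (band s).
Proof.
rewrite (_ : band s = cube d `*` cube d `&`
    \bigcap_(i in [set: 'I_d]) ((fun z :
      V * V => z.1 0 i - z.2 0 i) @^-1` `[- s, s])).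
  apply: measurableI; first by apply: measurableX; exact: measurable_cube.
  apply: fin_bigcap_measurable => // i _.
  rewrite -[X in measurable X]setTI.
  have mf : measurable_fun setT (fun z : V * V => z.1 0 i - z.2 0 i).
    apply: measurable_funB.
      exact: (measurableT_comp (measurable_entry 0 i) measurable_fst).
    exact: (measurableT_comp (measurable_entry 0 i) measurable_snd).
  exact: mf.
apply/seteqP; split => [z [z1 z2 h]|z [[z1 z2] h]].
  by split=> // i _ /=; rewrite in_itv/= -ler_norml.
by split=> // i; have := h i I; rewrite /= in_itv/= -ler_norml.
Qed.

(** Every section of the band is contained in a cube of side [2 * s]. *)
Lemma band_measure_le s :
  0 <= s -> ((mu \x mu)%E (band s) <= ((4 * s) ^+ d)%:E)%E.
Proof.
move=> s0; rewrite /product_measure1/=.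
pose g (x : V) := (((2 * s) ^+ d)%:E * (\1_(cube d : set V) x)%:E)%E.
apply: (@le_trans _ _ (\int[mu]_x g x)%E).
  apply: ge0_le_integral_nomeas => [x|x]; first by rewrite /=;
    exact: measure_ge0.
  rewrite /g indicE /=; case: (boolP (x \in _)) => [_|nx]; last first.
    rewrite (_ : xsection _ _ = set0) ?measure0 ?mule0//.
    apply/seteqP; split => // y; rewrite /xsection/= inE => -[/= cx _ _].
    by move: nx; rewrite notin_setE.
  rewrite mule1 -(@lebesgue_rV_box R d x s s0).
  apply: le_measure; rewrite ?inE.
  - by apply: measurable_xsection; exact: measurable_band.
  - exact: measurable_box.
  - by move=> y; rewrite /xsection/= inE => -[_ _ h] i; rewrite distrC;
    exact: h.
have k0 : 0 <= (2 * s) ^+ d by rewrite exprn_ge0// mulr_ge0.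
have mI : measurable_fun setT (EFin \o (\1_(cube d : set V) : V -> R)).
  by apply/measurable_EFinP; apply: measurable_indic; exact: measurable_cube.
rewrite /g ge0_integralZl_EFin//.
rewrite integral_indic// ?setIT; last exact: measurable_cube.
have Hc : mu (cube d) = (2 ^+ d)%:E.
  by rewrite cube_box lebesgue_rV_box// mulr1.
rewrite [X in (_ * X)%E]Hc -EFinM lee_fin -exprMn.
by rewrite mulrAC -natrM.
Qed.

(** A function that is dominated on each member of a countable cover is
    dominated by the sum of the corresponding multiples of indicators. Two
    families are kept apart because shells shrinking to the diagonal and shells
    growing away from it have different geometric ratios. *)
Lemma integral_dyadic_le d' (T : measurableType d')
    (nu : {measure set T -> \bar R}) (f : T -> \bar R) (E F : nat -> set T) (b c : nat -> R) (K L w v : R) :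
  (forall z, 0 <= f z)%E ->
  (forall j, measurable (E j)) -> (forall j, measurable (F j)) ->
  (forall j, 0 <= b j) -> (forall j, 0 <= c j) -> 0 <= K -> 0 <= L ->
  0 <= w < 1 -> 0 <= v < 1 ->
  (forall z, f z = 0%E \/ exists j,
    (E j z /\ (f z <= (b j)%:E)%E) \/ (F j z /\ (f z <= (c j)%:E)%E)) ->
  (forall j, (b j)%:E * nu (E j) <= (K * w ^+ j)%:E)%E ->
  (forall j, (c j)%:E * nu (F j) <= (L * v ^+ j)%:E)%E ->
  (\int[nu]_z f z <= (K / (1 - w) + L / (1 - v))%:E)%E.
Proof.
move=> f0 mE mF b0 c0 K0 L0 w1 v1 cover hb hc.
pose g j z := ((b j)%:E * (\1_(E j) z)%:E + (c j)%:E * (\1_(F j) z)%:E)%E.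
have gb0 j z : (0 <= (b j)%:E * (\1_(E j) z)%:E)%E by rewrite mule_ge0 ?lee_fin.
have gc0 j z : (0 <= (c j)%:E * (\1_(F j) z)%:E)%E by rewrite mule_ge0 ?lee_fin.
have g0 j z : (0 <= g j z)%E by rewrite adde_ge0.
have mgb j : measurable_fun setT (fun z => (b j)%:E * (\1_(E j) z)%:E)%E.
  by apply: measurable_funeM; apply/measurable_EFinP; exact: measurable_indic.
have mgc j : measurable_fun setT (fun z => (c j)%:E * (\1_(F j) z)%:E)%E.
  by apply: measurable_funeM; apply/measurable_EFinP; exact: measurable_indic.
have ig j : (\int[nu]_z g j z <= (K * w ^+ j + L * v ^+ j)%:E)%E.
  rewrite ge0_integralD// !ge0_integralZl_EFin//;
    try by apply/measurable_EFinP; exact: measurable_indic.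
  by rewrite !integral_indic// !setIT EFinD leeD.
apply: (@le_trans _ _ (\int[nu]_z (\sum_(j <oo) g j z))%E).
  apply: ge0_le_integral_nomeas => // z.
  have [->|[j hj]] := cover z; first by apply: nneseries_ge0.
  apply: (@le_trans _ _ (\sum_(0 <= i < j.+1) g i z)%E);
    last exact: nneseries_lim_ge.
  rewrite big_nat_recr//= (@le_trans _ _ (g j z))//; last first.
    by rewrite leeDr// sume_ge0.
  rewrite /g; case: hj => -[hz hfz].
    by rewrite (le_trans hfz)// indicE mem_set//= mule1 leeDl.
  by rewrite (le_trans hfz)// [\1_(F j) z]indicE mem_set//= mule1 leeDr.
rewrite integral_nneseries//; last by move=> j; exact: emeasurable_funD.
apply: lime_le; first by apply: is_cvg_nneseries => *; exact: integral_ge0.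
apply: nearW => n; rewrite big_mkord.
apply: (@le_trans _ _ (\sum_(j < n) (K * w ^+ j + L * v ^+ j)%:E)%E).
  by apply: lee_sum => j _; exact: ig.
rewrite sumEFin lee_fin big_split /= -!mulr_sumr.
by apply: lerD; apply: ler_wpM2l => //; exact: sum_geometric_le.
Qed.

End band.

(** * Lebesgue norms and the dyadic decomposition of the kernel *)

Lemma dyadic_ge1 (R : realType) (u : R) :
  1 < u -> exists j, 2 ^+ j < u <= 2 ^+ j.+1.
Proof.
move=> u1.
have ex : exists n, u <= 2 ^+ n.
  exists (Num.truncn u).+1; rewrite ltW// (lt_le_trans (truncnS_gt u))//.
  by rewrite -natrX ler_nat ltnW// ltn_expl.
case: (ex_minnP ex) => -[|n] hn mn; first by rewrite expr0 leNgt u1 in hn.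
exists n; rewrite hn andbT ltNge; apply/negP => /mn; by rewrite ltnn.
Qed.

Lemma dyadic_le1 (R : realType) (u : R) : 0 < u <= 1 ->
  exists j, (2 ^+ j.+1)^-1 < u <= (2 ^+ j)^-1.
Proof.
move=> /andP[u0 u1].
have ex : exists n, u^-1 < 2 ^+ n.
  exists (Num.truncn u^-1).+1; rewrite (lt_le_trans (truncnS_gt _))//.
  by rewrite -natrX ler_nat ltnW// ltn_expl.
case: (ex_minnP ex) => -[|n] hn mn.
  by move: hn; rewrite expr0 ltNge invf_ge1 ?u1.
exists n; rewrite invf_plt ?posrE ?exprn_gt0// hn /=.
rewrite -[u]invrK lef_pV2 ?posrE ?invr_gt0 ?exprn_gt0// leNgt.
by apply/negP => /mn; rewrite ltnn.
Qed.

Section norms.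
Context {R : realType} {d : nat}.
Local Notation V := 'rV[R]_d.
Local Notation mu := (@lebesgue_rV R d).

(** The factor [2 ^+ d] is the volume of the cube; since [1 / p <= 1] it serves
    for every exponent at once. *)
Lemma Lp_norm_le (p : \bar R) (v : V -> R) (L : R) : (1 <= p)%E -> 0 <= L ->
  (forall x, `|v x| <= L) -> (Lp_norm p v <= (L * 2 ^+ d)%:E)%E.
Proof.
have d1 : 1 <= 2 ^+ d :> R by rewrite exprn_ege1// ler1n.
move=> p1 L0 vL; rewrite /Lp_norm unlock; case: p p1 => [q| |] //= q1;
  last first.
  case: ifPn => _; last by rewrite lee_fin mulr_ge0// (le_trans ler01).
  apply/ess_supP; apply: aeW => x.
  rewrite /= lee_fin patchE; case: ifPn => _; last first.
    by rewrite normr0 mulr_ge0// (le_trans ler01).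
  by rewrite (le_trans (vL x))// ler_peMr.
rewrite lee_fin in q1; have q0 : 0 < q by lra.
have k0 : 0 <= L `^ q by exact: powR_ge0.
have mI : measurable_fun setT (EFin \o (\1_(cube d : set V) : V -> R)).
  by apply/measurable_EFinP; apply: measurable_indic; exact: measurable_cube.
have Hc : mu (cube d) = (2 ^+ d)%:E.
  by rewrite cube_box lebesgue_rV_box// mulr1.
have H : (\int[mu]_x ((L `^ q)%:E * (\1_(cube d :
  set V) x)%:E) = (L `^ q * 2 ^+ d)%:E)%E.
  rewrite ge0_integralZl_EFin//.
  rewrite integral_indic// ?setIT; last exact: measurable_cube.
  by rewrite EFinM; congr (_ * _)%E.
have : (\int[mu]_x (`|(EFin \o (v \_ (cube d))) x| `^ q) <= (L `^ q * 2 ^+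
  d)%:E)%E.
  rewrite -H; apply: ge0_le_integral_nomeas => x; first exact: poweR_ge0.
  rewrite /= indicE patchE; case: ifPn => hx; last first.
    by rewrite normr0 powR0 ?gt_eqF// mule0.
  by rewrite mule1 lee_fin ge0_ler_powR ?nnegrE// ltW.
move=> h; apply: (@le_trans _ _ ((L `^ q * 2 ^+ d)%:E `^ q^-1)%E).
  apply: gt0_ler_poweR => //; rewrite ?invr_ge0 ?in_itv/= ?leey ?andbT//.
  - exact: ltW.
  - by apply: integral_ge0 => x _; rewrite lee_fin powR_ge0.
  - by rewrite lee_fin mulr_ge0// exprn_ge0.
rewrite poweR_EFin lee_fin powRM ?exprn_ge0//.
rewrite -powRrM mulfV ?gt_eqF// powRr1// ler_wpM2l//.
by apply: ler1_powR => //; rewrite invf_le1.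
Qed.

(** The variable [u] is the distance of two points in units of 1/m. The kernel
    is bounded separately on the shells between consecutive powers of two, for
    [u > 1], where the minimum is 1, and for [u <= 1], where it is [u]. *)
Lemma kernel_dyadic (q sigma eta u : R) : 0 < q -> eta * q = d%:R + sigma * q ->
  0 <= eta -> 0 < u ->
  let T := 2 `^ (d%:R + sigma * q) in
  exists j : nat,
    (u <= 2 ^+ j.+1 /\ (Num.min 1 u / u `^ eta) `^ q <= (T ^+ j)^-1) \/
    (u <= (2 ^+ j)^-1 /\
      (Num.min 1 u / u `^ eta) `^ q <= T ^+ j.+1 / (2 `^ q) ^+ j).
Proof.
move=> q0 eq eta0 u0 T.
have TE j : ((2 ^+ j) `^ eta) `^ q = T ^+ j.
  by rewrite -powRrM eq -powR_mulrn//
    -!powRrM mulrC powRrM powR_mulrn ?powR_ge0.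
have pu : 0 < u `^ eta by exact: powR_gt0.
have [u1|u1] := leP u 1.
  have [|j /andP[uj1 uj2]] := dyadic_le1 _ u; first by rewrite u0.
  exists j; right; split=> //.
  have t0 : 0 < 2 ^+ j.+1 :> R by rewrite exprn_gt0.
  apply: (@le_trans _ _ (((2 ^+ j)^-1 * (2 ^+ j.+1) `^ eta) `^ q)).
    apply: ge0_ler_powR; rewrite ?nnegrE ?(ltW q0)//.
      by rewrite mulr_ge0 ?invr_ge0 ?powR_ge0// ltW.
    rewrite ler_pM ?invr_ge0 ?powR_ge0 ?(ltW u0)//.
    rewrite -powRN -[X in X `^ (- eta)]invrK.
    rewrite -powR_inv1 ?invr_ge0 ?(ltW u0)// -powRrM mulrN mulN1r opprK.
    apply: ge0_ler_powR; rewrite ?nnegrE ?invr_ge0 ?(ltW u0) ?(ltW t0)//.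
    by rewrite -[leRHS]invrK lef_pV2 ?posrE ?invr_gt0// ltW.
  rewrite powRM ?invr_ge0 ?exprn_ge0 ?powR_ge0//
    TE mulrC ler_wpM2l ?exprn_ge0 ?powR_ge0//.
  rewrite -powR_inv1 ?exprn_ge0// powRAC powR_inv1 ?powR_ge0//.
  by rewrite -powR_mulrn// powRAC powR_mulrn ?powR_ge0.
have [j /andP[uj1 uj2]] := dyadic_ge1 _ u u1.
exists j; left; split=> //; rewrite mul1r.
have t0 : 0 < 2 ^+ j :> R by rewrite exprn_gt0.
rewrite -TE -powR_inv1 ?powR_ge0// powRAC powR_inv1 ?powR_ge0//.
rewrite lef_pV2 ?posrE ?powR_gt0//.
apply: ge0_ler_powR; rewrite ?nnegrE ?powR_ge0 ?(ltW q0)//.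
by apply: ge0_ler_powR; rewrite ?nnegrE ?(ltW u0) ?(ltW t0)// ltW.
Qed.

End norms.

(** * The Slobodeckij and Hoelder seminorms *)

Section seminorms.
Context {R : realType} {d : nat}.
Local Notation V := 'rV[R]_d.
Local Notation mu := (@lebesgue_rV R d).

Section slobodeckij.
Variables (q sigma : R).
Hypotheses (q1 : 1 <= q) (sigma0 : 0 < sigma) (sigma1 : sigma < 1).

Let T : R := 2 `^ (d%:R + sigma * q).

(** The sum of the contributions of all dyadic shells. The first series, over
    distances above 1/m, converges because [sigma > 0]; the second, over
    distances below 1/m, because [sigma < 1]. *)
Definition dyadic_sum : R :=
  8 ^+ d / (1 - 2 ^+ d / T) + 4 ^+ d * T / (1 - T / (2 `^ q * 2 ^+ d)).

Let q0 : 0 < q. Proof. exact: lt_le_trans q1. Qed.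

Let T0 : 0 < T. Proof. exact: powR_gt0. Qed.

Let TE : T = 2 ^+ d * 2 `^ (sigma * q).
Proof. by rewrite /T powRD ?powR_mulrn// (gt_eqF (ltr0Sn _ _)) implybT. Qed.

Let ratio1 : 0 <= 2 ^+ d / T < 1.
Proof.
rewrite divr_ge0 ?exprn_ge0 ?(ltW T0)//= ltr_pdivrMr//
  mul1r TE ltr_pMr ?exprn_gt0//.
by rewrite -[ltLHS](powRr0 2) /powR !gt_eqF//
  mul0r expR0 expR_gt1 mulr_gt0 ?mulr_gt0 ?ln_gt0 ?ltr1n.
Qed.

Let ratio2 : 0 <= T / (2 `^ q * 2 ^+ d) < 1.
Proof.
have c0 : 0 < 2 `^ q * 2 ^+ d :> R by rewrite mulr_gt0 ?powR_gt0 ?exprn_gt0.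
rewrite divr_ge0 ?(ltW T0) ?(ltW c0)//= ltr_pdivrMr//
  mul1r TE mulrC ltr_pM2r ?exprn_gt0//.
rewrite /powR !gt_eqF// ltr_expR ltr_pM2r ?ln_gt0 ?ltr1n//.
by rewrite -[ltRHS]mul1r ltr_pM2r.
Qed.

Lemma dyadic_sum_ge0 : 0 <= dyadic_sum.
Proof.
have /andP[_ ?] := ratio1; have /andP[_ ?] := ratio2.
have ? := ltW T0.
by rewrite /dyadic_sum addr_ge0// divr_ge0 ?mulr_ge0 ?exprn_ge0 ?subr_ge0// ltW.
Qed.

Variables (v : V -> R) (L : R) (m : nat).
Hypotheses (m0 : (0 < m)%N) (L0 : 0 <= L).
Hypothesis vL : forall x y, `|v x - v y| <=
  L * m%:R `^ (- sigma) * Num.min 1 (m%:R * euclidean_norm (x - y)).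

Let eta : R := d%:R / q + sigma.

Let etaq : eta * q = d%:R + sigma * q.
Proof. by rewrite /eta mulrDl divfK// gt_eqF. Qed.

Let eta0 : 0 <= eta.
Proof. by rewrite /eta addr_ge0 ?(ltW sigma0)// divr_ge0// ltW. Qed.

Let mR0 : 0 < m%:R :> R. Proof. by rewrite ltr0n. Qed.

(** In the rescaled distance [u] the amplitude [m `^ - sigma] cancels against
    the kernel up to a factor [m ^+ d], which the volume of a shell, of order
    [m ^- d], absorbs. *)
Lemma slobodeckij_pow_le z :
  let u := m%:R * euclidean_norm (z.1 - z.2) in 0 < u ->
  slobodeckij q%:E sigma v z `^ q <=
  L `^ q * m%:R ^+ d * (Num.min 1 u / u `^ eta) `^ q.
Proof.
move=> u u0.
have rhoE : euclidean_norm (z.1 - z.2) = u / m%:R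
  by rewrite /u mulrAC mulfV ?mul1r// gt_eqF.
have -> : L `^ q * m%:R ^+ d * (Num.min 1 u / u `^ eta) `^ q =
    (L * m%:R `^ (d%:R / q) * (Num.min 1 u / u `^ eta)) `^ q.
  have min0 : 0 <= Num.min 1 u / u `^ eta.
    by rewrite divr_ge0 ?powR_ge0// le_min ler01 ltW.
  have Lm0 : 0 <= L * m%:R `^ (d%:R / q) by rewrite mulr_ge0 ?powR_ge0.
  rewrite (powRM _ Lm0 min0) (powRM _ L0) ?powR_ge0//.
  by rewrite -[in RHS](powRrM m%:R) divfK ?gt_eqF// powR_mulrn// ltW.
apply: ge0_ler_powR; rewrite ?nnegrE ?(ltW q0)//.
- by rewrite /slobodeckij divr_ge0 ?powR_ge0.
- by rewrite !mulr_ge0 ?powR_ge0 ?invr_ge0 ?powR_ge0// le_min ler01 ltW.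
rewrite /slobodeckij /dim_over -/eta ler_pdivrMr; last first.
  by rewrite powR_gt0// rhoE divr_gt0.
rewrite (le_trans (vL _ _))// -/u rhoE powRM ?invr_ge0 ?(ltW u0) ?(ltW mR0)//.
have -> : (m%:R^-1) `^ eta = (m%:R `^ eta)^-1 :> R.
  by rewrite -powR_inv1 ?(ltW mR0)// -powRrM mulN1r powRN.
have -> : m%:R `^ (- sigma) = m%:R `^ (d%:R / q) / m%:R `^ eta :> R.
  rewrite -powRB; first by congr (_ `^ _); rewrite /eta; ring.
  by apply/implyP => _; rewrite gt_eqF.
have p1 : u `^ eta != 0 by rewrite gt_eqF// powR_gt0.
have p2 : m%:R `^ eta != 0 :> R by rewrite gt_eqF// powR_gt0.
rewrite le_eqVlt; apply/orP; left; apply/eqP; field; exact/andP.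
Qed.

Lemma integral_slobodeckij_le :
  (\int[(mu \x mu)%E]_z
    (`|(EFin \o (slobodeckij q%:E sigma v \_ (cube d `*` cube d))) z| `^ q) <=
   (L `^ q * dyadic_sum)%:E)%E.
Proof.
have [T0' Lq0] := (ltW T0, powR_ge0 L q).
rewrite (_ : L `^ q * dyadic_sum =
  (L `^ q * 8 ^+ d) / (1 - 2 ^+ d / T) +
  (L `^ q * (4 ^+ d * T)) / (1 - T / (2 `^ q * 2 ^+ d))); last first.
  by rewrite /dyadic_sum mulrDr !mulrA.
apply: (@integral_dyadic_le _ _ _ _ _
  (fun j => band (2 ^+ j.+1 / m%:R)) (fun j => band ((2 ^+ j)^-1 / m%:R))
  (fun j => L `^ q * m%:R ^+ d / T ^+ j)
  (fun j => L `^ q * m%:R ^+ d * (T ^+ j.+1 / (2 `^ q) ^+ j))) => //.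
- by move=> z; exact: poweR_ge0.
- by move=> j; exact: measurable_band.
- by move=> j; exact: measurable_band.
- by move=> j; rewrite divr_ge0 ?mulr_ge0 ?exprn_ge0.
- by move=> j; rewrite !mulr_ge0 ?invr_ge0 ?exprn_ge0 ?powR_ge0.
- by rewrite mulr_ge0 ?exprn_ge0.
- by rewrite !mulr_ge0 ?exprn_ge0.
- move=> z; rewrite /= patchE; case: ifPn => [|_]; last first.
    by left; rewrite normr0 powR0// gt_eqF.
  rewrite inE => -[cz1 cz2].
  have := sqrtr_ge0 (\sum_i (z.1 - z.2) 0 i ^+ 2).
  rewrite -/(euclidean_norm (z.1 - z.2)) le_eqVlt => /predU1P[rho0|rho0].
    left; have := vL z.1 z.2.
    rewrite -rho0 mulr0 min_r// mulr0 normr_le0 => /eqP E.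
    by rewrite /slobodeckij E normr0 mul0r normr0 powR0// gt_eqF.
  right; rewrite ger0_norm; last by rewrite /slobodeckij divr_ge0 ?powR_ge0.
  have u0 : 0 < m%:R * euclidean_norm (z.1 - z.2) by rewrite mulr_gt0.
  have le := slobodeckij_pow_le z u0.
  have [j hj] := @kernel_dyadic _ d q sigma eta _ q0 etaq eta0 u0.
  have C0 : 0 <= L `^ q * m%:R ^+ d by rewrite mulr_ge0 ?exprn_ge0.
  have coord i (s : R) : m%:R * euclidean_norm (z.1 - z.2) <= s ->
      `|z.1 0 i - z.2 0 i| <= s / m%:R.
    move=> h; rewrite ler_pdivlMr// mulrC (le_trans _ h)// ler_pM2l//.
    by have := ler_coord_euclidean _ _ (z.1 - z.2) i; rewrite !mxE.
  exists j; case: hj => -[hu hk]; [left|right].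
    split; first by split=> // i; exact: coord.
    by rewrite lee_fin (le_trans le)// ler_wpM2l.
  split; first by split=> // i; exact: coord.
  by rewrite lee_fin (le_trans le)// ler_wpM2l.
- move=> j; have s0 : 0 <= 2 ^+ j.+1 / m%:R :> R by rewrite divr_ge0 ?exprn_ge0.
  have C0 : 0 <= L `^ q * m%:R ^+ d / T ^+ j
    by rewrite divr_ge0 ?mulr_ge0 ?exprn_ge0.
  rewrite (le_trans (lee_wpmul2l _ (band_measure_le _ s0)))// -EFinM lee_fin.
  rewrite le_eqVlt; apply/orP; left; apply/eqP.
  have -> : (8 : R) = 4 * 2 by ring.
  rewrite exprS !exprMn !exprVn -!exprM [(d * j)%N]mulnC.
  have p1 : m%:R ^+ d != 0 :> R by rewrite expf_neq0// gt_eqF.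
  have p2 : T ^+ j != 0 by rewrite expf_neq0// gt_eqF.
  by field; exact/andP.
- move=> j; have s0 : 0 <= (2 ^+ j)^-1 / m%:R :> R
  by rewrite divr_ge0 ?invr_ge0 ?exprn_ge0.
  have C0 : 0 <= L `^ q * m%:R ^+ d * (T ^+ j.+1 / (2 `^ q) ^+ j).
    by rewrite !mulr_ge0 ?invr_ge0 ?exprn_ge0 ?powR_ge0.
  rewrite (le_trans (lee_wpmul2l _ (band_measure_le _ s0)))// -EFinM lee_fin.
  rewrite le_eqVlt; apply/orP; left; apply/eqP.
  rewrite exprS !exprMn !exprVn !exprMn -!exprM [(d * j)%N]mulnC.
  have p1 : m%:R ^+ d != 0 :> R by rewrite expf_neq0// gt_eqF.
  have p2 : (2 `^ q) ^+ j != 0 :> R by rewrite expf_neq0// gt_eqF// powR_gt0.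
  have p3 : 2 ^+ (j * d) != 0 :> R by rewrite expf_neq0.
  by field; rewrite p1 p2 p3.
Qed.

Lemma Lp_norm2_slobodeckij_le :
  (Lp_norm2 q%:E (slobodeckij q%:E sigma v) <= (L * dyadic_sum `^ q^-1)%:E)%E.
Proof.
rewrite /Lp_norm2 unlock.
have S0 := dyadic_sum_ge0.
apply: (@le_trans _ _ ((L `^ q * dyadic_sum)%:E `^ q^-1)%E).
  apply: gt0_ler_poweR => //; rewrite ?invr_ge0 ?in_itv/= ?leey ?andbT//.
  - exact: ltW.
  - by apply: integral_ge0 => x _; rewrite lee_fin powR_ge0.
  - by rewrite lee_fin mulr_ge0 ?powR_ge0.
  exact: integral_slobodeckij_le.
rewrite poweR_EFin lee_fin powRM ?powR_ge0//.
by rewrite -powRrM mulfV ?gt_eqF// powRr1.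
Qed.

End slobodeckij.

(** This is [Num.min 1 u <= u `^ sigma] for the rescaled distance [u]. *)
Lemma hoelder_seminorm_le (sigma : R) (v : V -> R) (L : R) (m : nat) :
  0 < sigma < 1 -> (0 < m)%N -> 0 <= L ->
  (forall x y, `|v x - v y| <=
    L * m%:R `^ (- sigma) * Num.min 1 (m%:R * euclidean_norm (x - y))) ->
  (hoelder_seminorm sigma v <= L%:E)%E.
Proof.
move=> /andP[sigma0 sigma1] m0 L0 vL.
have mR0 : 0 < m%:R :> R by rewrite ltr0n.
apply: ge_ereal_sup => _ [z _ <-]; rewrite lee_fin.
have := sqrtr_ge0 (\sum_i (z.1 - z.2) 0 i ^+ 2).
rewrite -/(euclidean_norm (z.1 - z.2)) le_eqVlt => /predU1P[<-|rho0].
  by rewrite powR0 ?gt_eqF// invr0 mulr0.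
rewrite ler_pdivrMr ?powR_gt0// (le_trans (vL _ _))// -mulrA ler_wpM2l//.
rewrite powRN mulrC ler_pdivrMr ?powR_gt0// -powRM ?(ltW rho0) ?(ltW mR0)//.
rewrite [X in _ <= X `^ _]mulrC; set u := m%:R * _.
have u0 : 0 < u by rewrite mulr_gt0.
have [u1|u1] := leP u 1; first by rewrite ger1_powR ?u0// ltW.
rewrite -[leLHS](powRr0 u); apply: ler_powR; exact: ltW.
Qed.

End seminorms.

(** * The Sobolev norm of a sum of bumps *)

Section sobolev_norms.
Context {R : realType} {d : nat}.
Local Notation V := 'rV[R]_d.

Let N r : R := #|{: multi_index d r}|%:R.

Let N1 r : 1 <= N r.
Proof.
by rewrite /N ler1n; apply/card_gt0P; exists [ffun=> ord0].
Qed.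

(** Keeping multiplicities inside the power lets every bound on a sum of [q]-th
    powers be the [q]-th power of a bound. *)
Lemma powR_natM_le (n L q : R) : 1 <= n -> 0 <= L -> 1 <= q ->
  n * L `^ q <= (n * L) `^ q.
Proof.
move=> n1 L0 q1; rewrite powRM//; last by rewrite (le_trans ler01).
by rewrite ler_wpM2r ?powR_ge0// le1r_powR.
Qed.

Lemma sum_powR_le r (q L : R) (P : pred (multi_index d r))
    (X : multi_index d r -> \bar R) :
  1 <= q -> 0 <= L -> (forall g, P g -> 0 <= X g <= L%:E)%E ->
  (\sum_(g | P g) X g `^ q <= (N r * L `^ q)%:E)%E.
Proof.
move=> q1 L0 XL.
apply: (@le_trans _ _ (\sum_(g | P g) (L `^ q)%:E)%E).
  apply: lee_sum => g Pg; rewrite -poweR_EFin.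
  have /andP[X0 XL'] := XL g Pg.
  apply: gt0_ler_poweR => //; rewrite ?in_itv/= ?leey ?andbT// ?lee_fin//.
  by rewrite (le_trans ler01).
rewrite sumEFin lee_fin sumr_const -mulr_natl ler_wpM2r ?powR_ge0//.
by rewrite /N ler_nat max_card.
Qed.

Lemma root_powR_le (x : \bar R) (L q : R) : 1 <= q -> 0 <= L -> (0 <= x)%E ->
  (x <= (L `^ q)%:E)%E -> (x `^ q^-1 <= L%:E)%E.
Proof.
move=> q1 L0 x0 xL; have q0 : 0 < q by rewrite (lt_le_trans ltr01).
apply: (@le_trans _ _ ((L `^ q)%:E `^ q^-1)%E).
  apply: gt0_ler_poweR => //;
    rewrite ?invr_ge0 ?in_itv/= ?leey ?andbT ?lee_fin ?powR_ge0//.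
  exact: ltW.
by rewrite poweR_EFin -powRrM mulfV ?gt_eqF// powRr1.
Qed.

Lemma Lp_norm_ge0 (p : \bar R) (v : V -> R) : (0 <= Lp_norm p v)%E.
Proof. exact: Lnorm_ge0. Qed.

Lemma sobolev_norm_int_ge0 (p : \bar R) r (D : multi_index d r -> V -> R) :
  (0 <= sobolev_norm_int p D)%E.
Proof.
rewrite /sobolev_norm_int; case: p => [q| |]; first exact: poweR_ge0;
  by elim/big_ind : _ => // [x y x0 y0|g _]; rewrite ?le_max ?x0 ?Lp_norm_ge0.
Qed.

Lemma sobolev_norm_int_le (p : \bar R) r (D : multi_index d r -> V -> R)
  (L : R) :
  (1 <= p)%E -> 0 <= L ->
  (forall g, (mi_length g <= r)%N -> Lp_norm p (D g) <= L%:E)%E ->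
  (sobolev_norm_int p D <= (N r * L)%:E)%E.
Proof.
move=> p1 L0 DL; rewrite /sobolev_norm_int; case: p p1 DL => [q| |]// p1 DL.
  rewrite lee_fin in p1; apply: root_powR_le => //.
  - by rewrite mulr_ge0.
  - by apply: sume_ge0 => g _; exact: poweR_ge0.
  apply: le_trans (sum_powR_le _ q L _ _ p1 L0 _) _.
    by move=> g gr; rewrite Lp_norm_ge0 DL.
  by rewrite lee_fin powR_natM_le.
have NL : L <= N r * L by rewrite ler_peMl.
elim/big_ind : _ => [|x y xL yL|g gr].
- by rewrite lee_fin (le_trans L0).
- by rewrite ge_max xL.
- by rewrite (le_trans (DL g gr))// lee_fin.
Qed.

Lemma sobolev_norm_frac_le (p : \bar R) r (sigma : R)
    (D : multi_index d r -> V -> R) (L : R) :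
  (1 <= p)%E -> 0 <= L ->
  (forall g, (mi_length g <= r)%N -> Lp_norm p (D g) <= L%:E)%E ->
  (forall g, mi_length g == r ->
    (if p is +oo then hoelder_seminorm sigma (D g)
     else Lp_norm2 p (slobodeckij p sigma (D g))) <= L%:E)%E ->
  (sobolev_norm_frac p sigma D <= (3 * N r * L)%:E)%E.
Proof.
move=> p1 L0 DL SL; have := sobolev_norm_int_le p r D L p1 L0 DL.
have NL0 : 0 <= N r * L by rewrite mulr_ge0.
have NL : L <= N r * L by rewrite ler_peMl.
have NL3 : N r * L <= 3 * N r * L by rewrite -mulrA; lra.
rewrite /sobolev_norm_frac; case: p p1 DL SL => [q| |]// p1 DL SL hint;
  last first.
  rewrite ge_max; apply/andP; split; first by rewrite (le_trans hint)// lee_fin.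
  elim/big_ind : _ => [|x y xL yL|g gr].
  - by rewrite lee_fin (le_trans NL0).
  - by rewrite ge_max xL.
  - by rewrite (le_trans (SL g gr))// lee_fin (le_trans NL).
rewrite lee_fin in p1; have q0 : 0 <= q by rewrite (le_trans ler01).
have NLq : N r * L `^ q <= (N r * L) `^ q by exact: powR_natM_le.
apply: root_powR_le => //.
- by rewrite (le_trans NL0).
- rewrite adde_ge0 ?poweR_ge0// sume_ge0// => g _.
  by rewrite adde_ge0 ?poweR_ge0.
apply: (@le_trans _ _ ((N r * L) `^ q + ((N r * L) `^ q + (N r * L) `^ q))%:E).
  rewrite !EFinD leeD//.
    rewrite -poweR_EFin; apply: gt0_ler_poweR => //.
    - by rewrite in_itv/= leey andbT; exact: (sobolev_norm_int_ge0 q%:E r D).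
    - by rewrite in_itv/= leey andbT lee_fin.
  rewrite big_split/= leeD//.
  - apply: le_trans (sum_powR_le _ q L _ _ p1 L0 _) _.
      by move=> g /eqP gr; rewrite Lp_norm_ge0 DL// gr.
    by rewrite lee_fin.
  - apply: le_trans (sum_powR_le _ q L _ _ p1 L0 _) _.
      by move=> g gr; rewrite SL//= andbT; exact: Lnorm_ge0.
    by rewrite lee_fin.
rewrite lee_fin -mulrA.
apply: le_trans (powR_natM_le 3 _ _ _ NL0 p1); last by rewrite ler1n.
by rewrite -/(N r); lra.
Qed.

End sobolev_norms.

Section bump_sobolev.
Context {R : realType} {d : nat}.

(** A derivative of order [k] multiplies the sup norm by [m ^+ k], which the
    amplitude [m `^ - beta] compensates since [k <= beta]. At the top order the
    amplitude left over is [m `^ - sigma], exactly what the fractional seminorms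
    allow. *)
Lemma sobolev_norm_bump_le (p : \bar R) (beta : R) : (1 <= p)%E -> 0 < beta ->
  let r := Num.truncn beta in
  exists2 K : R, 0 < K & forall (m : nat) (a : R)
    (c : {ffun 'I_d -> 'I_m} -> R),
    (0 < m)%N -> 0 <= a -> (forall k, `|c k| <= a * m%:R `^ (- beta)) ->
    (sobolev_norm beta p (sepsum c (cell_factor d r m) (fun=> 0%N)) <=
      (a * K)%:E)%E.
Proof.
move=> p1 beta0 r.
have /andP[rb br] : r%:R <= beta < r.+1%:R by apply: truncn_itv; exact: ltW.
pose sigma := beta - r%:R.
have [B B1 hB] := @bump_bounded R r.
have B0 : 0 < B by exact: lt_le_trans B1.
have [A A0 AE] : exists2 A, 0 < A & 2 * (2 * d.+1%:R * B ^+ d.+1) = A.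
  by eexists; last reflexivity; rewrite !mulr_gt0 ?exprn_gt0 ?ltr0n.
pose S : R := if p is q%:E then @dyadic_sum R d q sigma `^ q^-1 else 0.
have S0 : 0 <= S by rewrite /S; case: (p) => // q; exact: powR_ge0.
have d1 : 1 <= 2 ^+ d :> R by rewrite exprn_ege1// ler1n.
pose Q := A * (2 ^+ d + S + 1).
have Q0 : 0 < Q by rewrite mulr_gt0//; lra.
pose N : R := #|{: multi_index d r}|%:R.
have N1 : 1 <= N by rewrite /N ler1n; apply/card_gt0P; exists [ffun=> ord0].
have N0 : 0 < N by exact: lt_le_trans N1.
exists (3 * N * Q).
  by apply: mulr_gt0 Q0; apply: mulr_gt0 N0.

move=> m a c m0 a0 ca.
have m1 : 1 <= m%:R :> R by rewrite ler1n.
have mR0 : 0 < m%:R :> R by rewrite ltr0n.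
have C0 : 0 <= a * m%:R `^ (- beta) by rewrite mulr_ge0 ?powR_ge0.
pose D (g : multi_index d r) := sepsum c (cell_factor d r m) (fun i => g i :
  nat).
have gr (g : multi_index d r) i : (g i <= r)%N by rewrite -ltnS.
have DL (g : multi_index d r) x : (mi_length g <= r)%N -> `|D g x| <= A * a.
  move=> gl; have := sepsum_bump_le d r m B B1 hB _ (gr g) c _ ca x C0.
  move=> /le_trans; apply; rewrite AE.
  rewrite -[A * _ * _]mulrA ler_wpM2l ?(ltW A0)// -mulrA ler_piMr//.
  rewrite -powR_mulrn ?(ltW mR0)// -powRD; last by apply/implyP => _;
    rewrite gt_eqF.
  rewrite -[leRHS](powRr0 m%:R) ler_powR//.
  have : (mi_length g)%:R <= r%:R :> R by rewrite ler_nat.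
  by rewrite /mi_length; lra.
have DS (g : multi_index d r) : mi_length g == r -> forall x y,
    `|D g x - D g y| <= A * a * m%:R `^ (- sigma) *
      Num.min 1 (m%:R * euclidean_norm (x - y)).
  move=> /eqP gl x y; have := sepsum_bump_dist d r m B B1 hB _ (gr g) c _ ca x
    y C0.
  move=> /le_trans; apply; rewrite AE.
  rewrite -powR_mulrn ?(ltW mR0)// -[(\sum_i g i)%N]/(mi_length g) gl.
  rewrite [A * _ * m%:R `^ r%:R](_ : _ = A * a * m%:R `^ (- sigma))//.
  rewrite -!mulrA -powRD; last by apply/implyP => _; rewrite gt_eqF.
  by congr (_ * (_ * _ `^ _)); rewrite /sigma; ring.
have Aa0 : 0 <= A * a by rewrite mulr_ge0// ltW.
have Lp g : (mi_length g <= r)%N -> (Lp_norm p (D g) <= (a * Q)%:E)%E.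
  move=> gl; apply: le_trans (Lp_norm_le p (D g) _ p1 Aa0 _) _.
    by move=> x; exact: DL.
  rewrite lee_fin /Q; nra.
have aQ0 : 0 <= a * Q by rewrite mulr_ge0// ltW.
rewrite /sobolev_norm; apply: ge_ereal_inf.
exists (if sigma == 0 then sobolev_norm_int p D else sobolev_norm_frac p sigma
  D).
  exists D => //= g gl; apply: weak_derivative_sepsum.
  - by move=> k i j s jr; apply: is_derive_cell_factor; exact: ltnW.
  - by move=> k i j jr; exact: continuous_cell_factor.
have NE : a * (3 * N * Q) = 3 * N * (a * Q) by ring.
case: eqVneq => [_|sN].
  apply: le_trans (sobolev_norm_int_le p r D (a * Q) p1 aQ0 Lp) _.
  rewrite lee_fin NE -mulrA ler_peMl ?mulr_ge0//; lra.
have s0 : 0 < sigma by rewrite lt_neqAle eq_sym sN /= /sigma; lra.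
have s1 : sigma < 1 by rewrite /sigma; move: br; rewrite -natr1; lra.
rewrite NE; apply: sobolev_norm_frac_le => // g gl.
move: (p) p1 @S S0 @Q Q0 Lp aQ0 NE => [q| |]// p1 S S0 Q Q0 Lp aQ0 NE.
  apply: le_trans (Lp_norm2_slobodeckij_le q sigma _ s0 s1 (D g) (A * a) m m0
    Aa0 (DS g gl)) _.
    by [].
  rewrite lee_fin -/S /Q; nra.
apply: le_trans (hoelder_seminorm_le sigma (D g) (A * a) m _ m0 Aa0 (DS g gl))
  _.
  by rewrite s0.
rewrite lee_fin /Q; nra.
Qed.

End bump_sobolev.

(** * The online game *)

Section potential.
Context {R : realType} (T : nat).
Hypothesis T0 : (0 < T)%N.

(** From [3 * u ^+ 2 - u ^+ 4 <= 2 * u] at [u = `|S| / (2 * sqrt T)] one gets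
    [sqrt T * (3 * S ^+ 2 / (4 * T) - S ^+ 4 / (16 * T ^+ 2)) <= `|S|].
    The potential is the expectation of the left-hand side after [j] more
    independent fair signs have been added to [S]. *)
Definition potential (S j : R) : R :=
  Num.sqrt T%:R * (3 / 4 * (S ^+ 2 + j) / T%:R -
    (S ^+ 4 + 6 * S ^+ 2 * j + 3 * j ^+ 2 - 2 * j) / (16 * T%:R ^+ 2)).

Let TR0 : 0 < T%:R :> R. Proof. by rewrite ltr0n. Qed.

Lemma potential_martingale S j :
  potential (S + 1) j + potential (S - 1) j = 2 * potential S (j + 1).
Proof. by rewrite /potential; field; rewrite gt_eqF. Qed.

Lemma potential_end S : potential S 0 <= `|S|.
Proof.
have s0 : 0 < Num.sqrt T%:R :> R by rewrite sqrtr_gt0.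
have sE : Num.sqrt T%:R ^+ 2 = T%:R :> R by rewrite sqr_sqrtr// ltW.
rewrite /potential; move: s0 sE; move: (Num.sqrt T%:R) => s s0 <-.
have -> : S ^+ 2 = `|S| ^+ 2 by rewrite real_normK ?num_real.
have -> : S ^+ 4 = `|S| ^+ 4 by rewrite -normrX ger0_norm// exprn_even_ge0.
have : 0 <= `|S| by [].
set u := `|S|; move=> u0.
have -> : s * (3 / 4 * (u ^+ 2 + 0) / s ^+ 2 -
  (u ^+ 4 + 6 * u ^+ 2 * 0 + 3 * 0 ^+ 2 - 2 * 0) / (16 * (s ^+ 2) ^+ 2)) =
  u - u * (u - 2 * s) ^+ 2 * (u + 4 * s) / (16 * s ^+ 3).
  by field; rewrite gt_eqF.
have u4 : 0 <= u + 4 * s by rewrite addr_ge0 ?mulr_ge0 ?(ltW s0).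
have s3 : 0 <= 16 * s ^+ 3 by rewrite mulr_ge0 ?exprn_ge0 ?(ltW s0).
rewrite lerBlDr lerDl; apply: divr_ge0 s3; apply: mulr_ge0 u4.
exact: mulr_ge0 u0 (sqr_ge0 _).
Qed.

Lemma potential_start : 9 / 16 * Num.sqrt T%:R <= potential 0 T%:R.
Proof.
rewrite /potential.
have -> : 3 / 4 * (0 ^+ 2 + T%:R) / T%:R - (0 ^+ 4 + 6 * 0 ^+ 2 * T%:R + 3 *
  T%:R ^+ 2 - 2 * T%:R) / (16 * T%:R ^+ 2)
  = 9 / 16 + 1 / (8 * T%:R) :> R by field; rewrite gt_eqF.
rewrite mulrC ler_wpM2l ?sqrtr_ge0// lerDl divr_ge0//; lra.
Qed.

End potential.

Section game.
Context {R : realType} {V : Type} (M : R) (pred : seq (V * R) -> V -> R).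

(** The loss of the learner [pred] on the data [ps] after the past [w], minus
    that of the constant prediction 0 when all labels are [M] or [- M]. *)
Fixpoint excess_loss (w ps : seq (V * R)) : R :=
  if ps is p :: ps' then
    (p.2 - pred w p.1) ^+ 2 - M ^+ 2 + excess_loss (rcons w p) ps'
  else 0.

Lemma excess_loss_cat w ps qs :
  excess_loss w (ps ++ qs) = excess_loss w ps + excess_loss (w ++ ps) qs.
Proof.
elim: ps w => [|p ps IH] w /=; first by rewrite cats0 add0r.
by rewrite IH cat_rcons addrA.
Qed.

Definition signs (ws : seq R) : Prop := forall s, s \in ws -> s = 1 \/ s = -1.

Definition block (x : V) (ws : seq R) :
  seq (V * R) := [seq (x, M * s) | s <- ws].

(** Averaged over the next label [M] or [- M], the squared loss exceeds
    [M ^+ 2] by the square of the prediction and the potential keeps its value.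
    The prediction does not depend on that label, so one of the two labels does
    at least as well as the average. *)
Lemma game_potential T (C : R) (x : V) (j : nat) (w : seq (V * R)) (S : R) :
  (0 < T)%N ->
  exists ws, [/\ size ws = j, signs ws &
    C * potential T S j%:R <=
    excess_loss w (block x ws) + C * potential T (S + \sum_(s <- ws) s) 0].
Proof.
move=> T0; elim: j w S => [|j IH] w S.
  by exists [::]; split=> //; rewrite big_nil addr0 add0r.
pose y := pred w x.
have [s [sE hs]] : exists s : R, (s = 1 \/ s = -1) /\
    C * potential T S j.+1%:R <=
    (M * s - y) ^+ 2 - M ^+ 2 + C * potential T (S + s) j%:R.
  have := potential_martingale T T0 S j%:R; rewrite natr1 => mart.
  have [h|h] := leP (C * potential T S j.+1%:R)
    ((M * 1 - y) ^+ 2 - M ^+ 2 + C * potential T (S + 1) j%:R).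
    by exists 1; split => //; left.
  exists (-1); split; first by right.
  have : 0 <= y ^+ 2 by exact: sqr_ge0.
  nra.
have [ws [wsj sws hws]] := IH (rcons w (x, M * s)) (S + s).
exists (s :: ws); split => /=; first by rewrite wsj.
  by move=> t; rewrite inE => /predU1P[->//|/sws].
by rewrite big_cons addrA -/y; lra.
Qed.

Lemma game_block T (C : R) (x : V) (w : seq (V * R)) : (0 < T)%N -> 0 <= C ->
  exists ws, [/\ size ws = T, signs ws &
    C * (9 / 16 * Num.sqrt T%:R) <=
    excess_loss w (block x ws) + C * `|\sum_(s <- ws) s|].
Proof.
move=> T0 C0; have [ws [s1 s2 h]] := game_potential T C x T w 0 T0.
exists ws; split=> //; rewrite add0r in h.
have := ler_wpM2l C0 (potential_start T T0).
have := ler_wpM2l C0 (potential_end T T0 (\sum_(s <- ws) s)).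
lra.
Qed.

(** With weight 0 on the potential, [game_potential] spends rounds without
    letting the learner gain anything. *)
Lemma game_idle (x : V) (w : seq (V * R)) (j : nat) :
  exists ws, [/\ size ws = j, signs ws & 0 <= excess_loss w (block x ws)].
Proof.
have [ws [s1 s2 h]] := game_potential 1 0 x j w 0 (ltn0Sn _).
by exists ws; split=> //; rewrite !mul0r addr0 in h.
Qed.

Lemma game_blocks (K : eqType) (xc : K -> V) (s : seq K) T (C : R)
  (w : seq (V * R)) :
  (0 < T)%N -> 0 <= C -> uniq s ->
  exists ws : K -> seq R, [/\ forall k, k \in s -> size (ws k) = T,
    forall k, k \in s -> signs (ws k) &
    (size s)%:R * (C * (9 / 16 * Num.sqrt T%:R)) <=
    excess_loss w (flatten [seq block (xc k) (ws k) | k <- s]) +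
    \sum_(k <- s) C * `|\sum_(s <- ws k) s|].
Proof.
move=> T0 C0; elim: s w => [|k s IH] w.
  by exists (fun=> [::]); split=> //=; rewrite big_nil !mul0r addr0.
move=> /= /andP[ks us].
have [ws0 [a1 a2 a3]] := game_block T C (xc k) w T0 C0.
have [ws [b1 b2 b3]] := IH (w ++ block (xc k) ws0) us.
exists (fun l => if l == k then ws0 else ws l); split.
- by move=> l; rewrite inE; case: eqP => //= _ /b1.
- by move=> l; rewrite inE; case: eqP => //= _ /b2.
rewrite big_cons eqxx excess_loss_cat.
have ne l : l \in s -> (l == k) = false.
  by move=> ls; apply/negbTE; apply: contraNN ks => /eqP <-.
have -> : [seq block (xc l) (if l == k then ws0 else ws l) | l <- s] =
          [seq block (xc l) (ws l) | l <- s].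
  by apply/eq_in_map => l ls; rewrite ne.
have -> : \sum_(l <- s) C * `|\sum_(t <- (if l == k then ws0 else ws l)) t| =
          \sum_(l <- s) C * `|\sum_(t <- ws l) t|.
  by apply: eq_big_seq => l ls; rewrite ne.
rewrite -natr1; lra.
Qed.

End game.

Section minimax.
Context {R : realType} {dV : measure_display} {V : measurableType dV}.

Lemma predictions_ext (A : @rule R dV V) (z z' : nat -> V * R) t :
  (forall i, (i < t)%N -> z i = z' i) -> predictions A z t = predictions A z' t.
Proof.
elim: t => [//|t IH] zz' /=.
have -> : [tuple z i | i < t] = [tuple z' i | i < t].
  by apply: eq_from_tnth => i; rewrite !tnth_mktuple zz'// ltnW// ltnS.
by rewrite IH ?zz'// => i it; rewrite zz'// ltnW.
Qed.

Lemma tnth_predictions (A : @rule R dV V) (z : nat -> V * R) n (t : 'I_n) :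
  tnth (predictions A z n) t =
  A t (predictions A z t, [tuple z i | i < t], (z t).1).
Proof.
elim: n t => [[]//|n IH] t /=.
rewrite (tnth_nth 0) /= nth_rcons size_tuple.
have [tn|] := ltnP t n.
  have -> : t = widen_ord (leqnSn n) (Ordinal tn) by apply/val_inj.
  by rewrite /= -(IH (Ordinal tn)) (tnth_nth 0).
move=> nt; have tn : t = n :> nat by apply/eqP;
  rewrite eqn_leq nt -ltnS ltn_ord.
by rewrite tn eqxx.
Qed.

(** The prediction as a function of the past data and the current input. The
    default value [point] is never read, as only indices below the length of
    the past occur. *)
Definition forecast (A : @rule R dV V) (w : seq (V * R)) (x : V) : R :=
  A (size w) (predictions A (nth point w) (size w),
    [tuple (nth point w) i | i < size w], x).

Lemma sum_sqr_loss (A : @rule R dV V) (M : R) n (z : n.-tuple (V * R)) :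
  \sum_(t < n) ((tnth z t).2 - tnth (predictions A (nth point z) n) t) ^+ 2 =
  excess_loss M (forecast A) [::] z + n%:R * M ^+ 2.
Proof.
have E : forall ps w, excess_loss M (forecast A) w ps + (size ps)%:R * M ^+ 2 =
    \sum_(t < size ps) ((nth point ps t).2 -
       forecast A (w ++ take t ps) (nth point ps t).1) ^+ 2.
  elim=> [|p ps IH] w /=; first by rewrite big_ord0 mul0r addr0.
  rewrite big_ord_recl /= cats0 -natr1.
  under eq_bigr => i _ do rewrite /= -cat_rcons.
  by rewrite -IH; ring.
have := E z [::]; rewrite size_tuple => ->.
apply: eq_bigr => t _; rewrite (tnth_nth point); congr ((_ - _) ^+ 2).
rewrite tnth_predictions /forecast cat0s.
have st : size (take t z) = t by rewrite size_takel// size_tuple ltnW.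
have E1 : predictions A (nth point z) t = predictions A (nth point (take t z))
  t.
  by apply: predictions_ext => i it; rewrite nth_take.
have E2 : [tuple nth point z i | i < t] = [tuple nth point (take t z) i | i <
  t].
  by apply: eq_from_tnth => i; rewrite !tnth_mktuple nth_take.
by rewrite st E1 E2.
Qed.

(** The adversary asks [T] questions at each of the points [xc k], with labels
    [M] or [- M] against which the learner should not beat the constant 0. A
    function in the class that takes the value [h] or [- h] at [xc k],
    according to the majority of the labels there, gains
    [2 * M * h * `|S| - T * h ^+ 2] over that constant, where [S] is the sum of
    the signs. The remaining rounds are spent at [x0], where that function and
    the constant agree. *)
Lemma minimax_regret_ge (X : set V) (Yhat : set R) (F : set (V -> R)) (M h : R)
    (K : finType) (xc : K -> V) (x0 : V) (T n : nat) :
  0 < M -> 0 < h -> (0 < T)%N -> (#|K| * T <= n)%N ->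
  (forall k, X (xc k)) -> X x0 ->
  h * Num.sqrt T%:R <= M / 8 ->
  (forall e : K -> bool, exists2 f, F f &
    (forall k, f (xc k) = (-1) ^+ e k * h) /\ f x0 = 0) ->
  ((#|K|%:R * h * Num.sqrt T%:R * M)%:E <=
   minimax_regret X [set y : R | (- M <= y <= M)%R] Yhat F n)%E.
Proof.
move=> M0 h0 T0 KTn Xc X0 hT richF.
apply: le_ereal_inf_tmp => _ [A _ <-].
have C0 : 0 <= 2 * M * h by rewrite !mulr_ge0 ?ltW.
have [ws [sz sg hws]] := game_blocks M (forecast A) K xc (enum K) T (2 * M * h)
  [::] T0 C0 (enum_uniq _).
set ps := flatten _ in hws.
have [tail [tsz tsg htail]] := game_idle M (forecast A) x0 ps (n - #|K| * T).
have kE (k : K) : k \in enum K by rewrite mem_enum.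
have szz : size (ps ++ block M x0 tail) = n.
  rewrite size_cat size_map tsz size_flatten /shape -map_comp.
  rewrite (eq_map (g := fun=> T)); last by move=> k /=; rewrite size_map sz.
  by rewrite sumnE big_map big_const_seq count_predT -cardE iter_addn_0 mulnC
    subnKC.
have szt : size (ps ++ block M x0 tail) == n by rewrite szz.
pose z : n.-tuple (V * R) := Tuple szt.
have ptsP p : p \in (z : seq _) -> X p.1 /\ (p.2 = M \/ p.2 = - M).
  have Ms x0' (w : seq R) q : X x0' -> signs w -> q \in block M x0' w ->
      X q.1 /\ (q.2 = M \/ q.2 = - M).
    move=> Xx sw /mapP[s /sw sE ->] /=; split=> //.
    by case: sE => ->; [left; rewrite mulr1|right; rewrite mulrN1].
  rewrite mem_cat => /orP[/flatten_mapP[k _]|]; last exact: Ms.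
  by apply: Ms => //; exact: sg.
apply: le_ereal_sup_tmp; exists (regret F A z).
  exists z => // i; have [Xi Yi] := ptsP _ (mem_tnth i z).
  by split=> //=; case: Yi => ->; apply/andP; split; lra.
have [f Ff [fc f0]] := richF (fun k => \sum_(s <- ws k) s < 0).
apply: le_ereal_sup_tmp; eexists; first by exists f.
rewrite lee_fin (sum_sqr_loss A M) excess_loss_cat.
have -> : \sum_(t < n) ((tnth z t).2 - f (tnth z t).1) ^+ 2 =
    n%:R * M ^+ 2 - \sum_(k <- enum K) (2 * M * h) * `|\sum_(s <- ws k) s| +
    #|K|%:R * (T%:R * h ^+ 2).
  transitivity (\sum_(p <- z) (p.2 - f p.1) ^+ 2).
    by rewrite [RHS]big_tuple.
  transitivity (\sum_(p <- z) (M ^+ 2 + (- 2 * p.2 * f p.1 + f p.1 ^+ 2))).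
    apply: eq_big_seq => p /ptsP[_ [->|->]]; ring.
  rewrite big_split /= big_const_seq count_predT szz iter_addr_0.
  rewrite -addrA; congr (_ + _); first by rewrite mulr_natl.
  rewrite big_cat /= [X in _ + X]big1_seq ?addr0; last first.
    by move=> p /andP[_ /mapP[s _ ->]] /=; rewrite f0; ring.
  rewrite big_flatten big_map -sumrN.
  have -> : #|K|%:R * (T%:R * h ^+ 2) = \sum_(k <- enum K) T%:R * h ^+ 2.
    by rewrite big_const_seq count_predT -cardE iter_addr_0 mulr_natl.
  rewrite -big_split /=; apply: eq_bigr => k _.
  rewrite big_map /= big_split /= big_const_seq count_predT sz// iter_addr_0.
  rewrite fc -mulr_suml -mulr_sumr -mulr_sumr exprMn sqrr_sign mul1r.
  congr (_ + _); last by rewrite mulr_natl.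
  have [S0|S0] := ltP (\sum_(s <- ws k) s) 0.
    by rewrite ltr0_norm//=; ring.
  by rewrite ger0_norm//=; ring.
have Tsq : T%:R = Num.sqrt T%:R ^+ 2 :> R by rewrite sqr_sqrtr.
rewrite -cardE in hws; rewrite /= -/ps.
set s := Num.sqrt _ in hT hws Tsq *.
have s0 : 0 <= s by exact: sqrtr_ge0.
have hs0 : 0 <= h * s by rewrite mulr_ge0// ltW.
have K0 : 0 <= #|K|%:R :> R by [].
have KT : #|K|%:R * (T%:R * h ^+ 2) <= #|K|%:R * (h * s * (M / 8)).
  have -> : T%:R * h ^+ 2 = h * s * (h * s) by rewrite Tsq; ring.
  by rewrite !ler_wpM2l.
have : #|K|%:R * (2 * M * h * (9 / 16 * s)) - #|K|%:R * (h * s * (M / 8)) =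
  #|K|%:R * h * s * M by field.
lra.
Qed.

End minimax.

(** * Choice of the grid and the lower bound *)

Section packing.
Context {R : realType} (d r m : nat).
Hypotheses (d1 : (1 <= d)%N) (m0 : (0 < m)%N).
Local Notation cell := {ffun 'I_d -> 'I_m}.

Definition cell_center (k : cell) : 'rV[R]_d :=
  \row_i (((k i)%:R + 2^-1) / m%:R).

Let mR0 : 0 < m%:R :> R. Proof. by rewrite ltr0n. Qed.

Lemma local_coord_center k i : local_coord d m k (cell_center k) i = 2^-1 :> R.
Proof. by rewrite /local_coord mxE; field; rewrite gt_eqF. Qed.

Lemma in_cell_center k : in_cell d m k (cell_center k).
Proof.
by apply/forallP => i;
  rewrite local_coord_center invr_gt0 ltr0n invf_lt1 ?ltr1n.
Qed.

Lemma cube_cell_center k : cube d (cell_center k).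
Proof.
move=> i; rewrite mxE.
have : (k i).+1%:R <= m%:R :> R by rewrite ler_nat.
rewrite -natr1 => km; have k0 : 0 <= (k i)%:R :> R by [].
by apply/andP; split; [rewrite ler_pdivlMr//|rewrite ler_pdivrMr//]; lra.
Qed.

Lemma sepsum_center (c : cell -> R) k :
  sepsum c (cell_factor d r m) (fun=> 0%N) (cell_center k) =
  c k * poly_bump r 0 2^-1 ^+ d.
Proof.
rewrite sepsum_cell_factor big1 ?expr0 ?mul1r//
  (bigD1 k)//= [X in _ + X]big1 ?addr0.
  by under eq_bigr do rewrite local_coord_center; rewrite prodr_const card_ord.
move=> l lk; rewrite bump_prod_out ?mulr0//.
by apply: contraNN lk => /in_cell_inj -/(_ _ (in_cell_center k)) ->.
Qed.

Lemma sepsum_origin (c : cell -> R) :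
  sepsum c (cell_factor d r m) (fun=> 0%N) 0 = 0.
Proof.
rewrite sepsum_cell_factor [X in _ * X]big1 ?mulr0// => k _;
  rewrite bump_prod_out ?mulr0//.
rewrite negb_forall; apply/existsP; exists (Ordinal d1).
by rewrite /local_coord mxE mulr0 sub0r oppr_gt0 ltrn0.
Qed.

End packing.

Section lower_bound.
Context {R : realType}.

Lemma truncn_powR (e : R) (n : nat) : 0 < e -> (1 <= n)%N ->
  let m := Num.truncn (n%:R `^ e^-1) in
  [/\ (0 < m)%N, m%:R `^ e <= n%:R & n%:R `^ e^-1 <= 2 * m%:R].
Proof.
move=> e0 n1 m.
have n1R : 1 <= n%:R :> R by rewrite ler1n.
have p0 : 0 <= n%:R `^ e^-1 by exact: powR_ge0.
have p1 : 1 <= n%:R `^ e^-1.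
  by rewrite -[leLHS](powRr0 n%:R) ler_powR// invr_ge0 ltW.
have /andP[le lt] := truncn_itv p0; rewrite -/m in le lt.
have m0 : (0 < m)%N.
  by rewrite lt0n; apply/eqP => m0; rewrite m0 in lt; lra.
have m1R : 1 <= m%:R :> R by rewrite ler1n.
split => //; last by rewrite -natr1 in lt; lra.
have -> : n%:R = (n%:R `^ e^-1) `^ e :> R.
  by rewrite -powRrM mulVf ?gt_eqF// powRr1// (le_trans ler01).
by apply: ge0_ler_powR; rewrite ?nnegrE ?(ltW e0).
Qed.

(** The amplitude [a] is fixed once and for all, small enough for the functions
    to stay in the ball and for [h * sqrt T <= M / 8]. The resolution [m] and
    the number [T] of visits per cell remain free. *)
Lemma minimax_regret_cells (M : R) (p : \bar R) (d : nat) (beta W : R) :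
  0 < M -> (1 <= p)%E -> (1 <= d)%N -> 0 < beta -> 0 < W ->
  exists2 C : R, 0 < C & forall (Yhat : set R) (n m T : nat),
    (0 < m)%N -> (0 < T)%N -> (m ^ d * T <= n)%N ->
    m%:R `^ (- beta) * Num.sqrt T%:R <= W ->
    ((C * m%:R ^+ d * (m%:R `^ (- beta) * Num.sqrt T%:R))%:E <=
      minimax_regret (cube d) [set y : R | (- M <= y <= M)%R] Yhat
        (sobolev_ball beta p M) n)%E.
Proof.
move=> M0 p1 d1 beta0 W0.
have [K K0 normK] := @sobolev_norm_bump_le R d p beta p1 beta0.
set r := Num.truncn beta in normK.
pose b := poly_bump r 0 2^-1 ^+ d : R.
have b0 : 0 < b by rewrite exprn_gt0// bump_half.
pose a := Num.min (M / (2 * K)) (M / (8 * W * b)).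
have a0 : 0 < a by rewrite lt_min !divr_gt0 ?mulr_gt0.
have aK : a * K < M.
  have : a * K <= M / (2 * K) * K by rewrite ler_wpM2r ?(ltW K0)// ge_min lexx.
  have -> : M / (2 * K) * K = M / 2 by field; rewrite gt_eqF.
  lra.
have aW : a * b * W <= M / 8.
  have : a * (b * W) <= M / (8 * W * b) * (b * W).
    by rewrite ler_wpM2r ?mulr_ge0 ?(ltW b0) ?(ltW W0)// ge_min lexx orbT.
  have -> : M / (8 * W * b) * (b * W) = M / 8 by field; rewrite !gt_eqF.
  by rewrite mulrA.
exists (a * b * M); first by rewrite !mulr_gt0.
move=> Yhat n m T m0 T0 mTn hW.
have mR0 : 0 < m%:R :> R by rewrite ltr0n.
pose h := a * m%:R `^ (- beta) * b.
have h0 : 0 < h by rewrite !mulr_gt0 ?powR_gt0.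
have cardK : #|{ffun 'I_d -> 'I_m}| = (m ^ d)%N by rewrite card_ffun !card_ord.
have := @minimax_regret_ge R _ _ (cube d) Yhat (sobolev_ball beta p M) M h
  {ffun 'I_d -> 'I_m} (cell_center d m) 0 T n M0 h0 T0.
rewrite cardK => /(_ mTn).
have -> : a * b * M * m%:R ^+ d * (m%:R `^ (- beta) * Num.sqrt T%:R) =
    (m ^ d)%:R * h * Num.sqrt T%:R * M by rewrite natrX /h; ring.
apply.
- by move=> k; exact: cube_cell_center.
- by move=> i; rewrite mxE lerN10 ler01.
- apply: le_trans aW; rewrite /h.
  rewrite [leLHS](_ : _ = a * b * (m%:R `^ (- beta) * Num.sqrt T%:R));
    last by ring.
  by rewrite ler_wpM2l// mulr_ge0 ?ltW.
move=> e.
pose c (k : {ffun 'I_d -> 'I_m}) := (-1) ^+ e k * (a * m%:R `^ (- beta)).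
exists (sepsum c (cell_factor d r m) (fun=> 0%N)).
  split.
    apply: continuous_subspaceT; apply: (@continuous_sepsum _ _ _ _ _ r) => //.
    by move=> k i j jr; exact: continuous_cell_factor.
  apply: le_lt_trans (normK m a c m0 (ltW a0) _) _; last by rewrite lte_fin.
  by move=> k; rewrite /c normrMsign ger0_norm// mulr_ge0 ?powR_ge0// ltW.
split; last by rewrite sepsum_origin.
by move=> k; rewrite sepsum_center// /c /h -!mulrA.
Qed.

End lower_bound.

Theorem theorem9 (R : realType) (M : R) (p : \bar R) (d : nat) (beta : R) :
  0 < M -> (1 <= p)%E -> (1 <= d)%N -> dim_over d p < beta ->
  exists C1 C2 : R, [/\ 0 < C1, 0 < C2 &
    forall (Yhat : set R) (n : nat), (1 <= n)%N ->
      ((if beta <= d%:R / 2 then C1 * n%:R `^ (1 - beta / d%:R)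
        else C2 * n%:R `^ (1 - 2 * beta / (2 * beta + d%:R)))%:E
       <= minimax_regret (cube d) [set y : R | (- M <= y <= M)%R] Yhat
            (sobolev_ball beta p M) n)%E].
Proof.
move=> M0 p1 d1 pbeta.
have dR0 : 0 < d%:R :> R by rewrite ltr0n.
have beta0 : 0 < beta.
  apply: le_lt_trans pbeta; case: p p1 => [q| |]//=; rewrite lee_fin => q1.
  by rewrite divr_ge0// (le_trans ler01).
pose e := 2 * beta + d%:R.
have e0 : 0 < e by rewrite addr_gt0 ?mulr_gt0.
pose W : R := 2 `^ e.
have W1 : 1 <= W by rewrite -[leLHS](powRr0 2) ler_powR ?ler1n// ltW.
have [C C0 hC] := minimax_regret_cells M p d beta W M0 p1 d1 beta0
  (lt_le_trans ltr01 W1).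
exists (C * 2 `^ (beta - d%:R)), (C / 2 / 2 ^+ d); split.
- by rewrite mulr_gt0 ?powR_gt0.
- by rewrite !divr_gt0 ?exprn_gt0.
move=> Yhat n n1.
have n0R : 0 < n%:R :> R by rewrite ltr0n.
case: ifPn => [betad|].
  (* One visit per cell; the number of cells is n up to a constant. *)
  have [m0 mn nm] := truncn_powR d%:R n dR0 n1;
    move: (Num.truncn _) m0 mn nm => m m0 mn nm.
  have m1R : 1 <= m%:R :> R by rewrite ler1n.
  have mR0 : 0 < m%:R :> R by rewrite ltr0n.
  apply: le_trans (hC Yhat n m 1%N m0 isT _ _); last 2 first.
  - by rewrite muln1 -(@ler_nat R) natrX -powR_mulrn// ltW.
  - rewrite sqrtr1 mulr1 (le_trans _ W1)// -[leRHS](powRr0 m%:R) ler_powR//;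
    lra.
  rewrite lee_fin sqrtr1 mulr1 -!mulrA ler_wpM2l ?(ltW C0)//.
  rewrite -powR_mulrn ?(ltW mR0)// -powRD; last by apply/implyP => _;
    rewrite gt_eqF.
  have -> : n%:R `^ (1 - beta / d%:R) = (n%:R `^ d%:R^-1) `^ (d%:R - beta) :> R.
    by rewrite -powRrM; congr (_ `^ _); field; rewrite gt_eqF.
  have -> : beta - d%:R = - (d%:R - beta) by ring.
  rewrite powRN mulrC ler_pdivrMr ?powR_gt0// -powRM ?(ltW mR0)//
    [m%:R * 2]mulrC.
  by apply: ge0_ler_powR; rewrite ?nnegrE ?powR_ge0 ?mulr_ge0 ?(ltW mR0)//; lra.
rewrite -ltNge => betad.
(* The number of cells is n ^ (d / e) up to a constant, which leaves T of order
   m ^ (2 * beta), so that x below stays between two positive constants. *)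
have [m0 mn nm] := truncn_powR e n e0 n1;
  move: (Num.truncn _) m0 mn nm => m m0 mn nm.
have m1R : 1 <= m%:R :> R by rewrite ler1n.
have mR0 : 0 < m%:R :> R by rewrite ltr0n.
have md0 : (0 < m ^ d)%N by rewrite expn_gt0 m0.
have mdR : (m ^ d)%:R = m%:R `^ d%:R :> R by rewrite powR_mulrn ?natrX// ltW.
have mdn : (m ^ d <= n)%N.
  rewrite -(@ler_nat R) mdR (le_trans _ mn)// ler_powR//.
  by rewrite /e lerDr mulr_ge0// ltW.
pose T := (n %/ m ^ d)%N.
have T0 : (0 < T)%N by rewrite divn_gt0.
have T1R : 1 <= T%:R :> R by rewrite ler1n.
have Tn : T%:R * m%:R `^ d%:R <= n%:R :> R.
  by rewrite -mdR -natrM ler_nat leq_trunc_div.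
have nT : n%:R <= 2 * T%:R * m%:R `^ d%:R :> R.
  have : n%:R <= T.+1%:R * m%:R `^ d%:R :> R.
    by rewrite -mdR -natrM ler_nat ltnW// ltn_ceil.
  rewrite -natr1; have : 0 < m%:R `^ d%:R :> R by exact: powR_gt0.
  nra.
pose x : R := m%:R `^ (- beta) * Num.sqrt T%:R.
have x0 : 0 <= x by rewrite mulr_ge0 ?powR_ge0 ?sqrtr_ge0.
have x2 : x ^+ 2 * m%:R `^ e = T%:R * m%:R `^ d%:R.
  rewrite /x exprMn sqr_sqrtr// /e powRD; last by apply/implyP => _;
    rewrite gt_eqF.
  rewrite powRN [2 * beta]mulrC powRrM (powR_mulrn 2) ?powR_ge0//.
  by field; rewrite gt_eqF// powR_gt0.
have me0 : 0 < m%:R `^ e :> R by exact: powR_gt0.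
have ne : n%:R <= W * m%:R `^ e :> R.
  have -> : n%:R = (n%:R `^ e^-1) `^ e :> R.
    by rewrite -powRrM mulVf ?gt_eqF// powRr1// ltW.
  rewrite -powRM ?(ltW mR0)//.
  by apply: ge0_ler_powR;
    rewrite ?nnegrE ?powR_ge0 ?mulr_ge0 ?(ltW mR0) ?(ltW e0).
have xW : x <= W.
  have : x ^+ 2 <= W by rewrite -(ler_pM2r me0) x2 (le_trans Tn).
  nra.
have xh : 1 / 2 <= x.
  have : 1 / 2 <= x ^+ 2.
    by rewrite -(ler_pM2r me0) x2; lra.
  nra.
apply: le_trans (hC Yhat n m T m0 T0 _ xW); last by rewrite mulnC leq_trunc_div.
rewrite lee_fin -/x.
have -> : n%:R `^ (1 - 2 * beta / (2 * beta + d%:R)) = (n%:R `^ e^-1) ^+ d :> R.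
  rewrite -powR_mulrn ?powR_ge0// -powRrM; congr (_ `^ _).
  by rewrite /e; field; rewrite gt_eqF.
apply: (@le_trans _ _ (C * m%:R ^+ d * (1 / 2))); last first.
  by rewrite ler_wpM2l// mulr_ge0 ?(ltW C0)// exprn_ge0// ltW.
have : (n%:R `^ e^-1) ^+ d <= 2 ^+ d * m%:R ^+ d.
  by rewrite -exprMn lerXn2r ?nnegrE ?powR_ge0// mulr_ge0// ltW.
move=> hn; rewrite -mulrA.
have -> : C * m%:R ^+ d * (1 / 2) = C / 2 * m%:R ^+ d by ring.
rewrite -!mulrA ler_wpM2l ?(ltW C0)// ler_wpM2l ?invr_ge0//.
by rewrite mulrC ler_pdivrMr ?exprn_gt0// mulrC.
Qed.
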